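(* Let $C$ be a circle of perimeter $1$, let $L$ be a line segment of length $\tfrac12$, and let $R$ be a rectangle of size $0.1727\times 0.3273$. If $S\subset\mathbb{R}^2$ is a convex set which contains a copy of each of $C$, $L$ and $R$ obtained by some rotation and translation (possibly different for each of the three shapes), then the area of $S$ is at least $0.1$.
   Context: A ''convex cover'' for a family of plane figures is a convex set in which each figure of the family can be placed after a suitable rotation and translation. *)

(* Defs.v *)
From HB Require Import structures.
From mathcomp Require Import all_boot all_order all_algebra.
From mathcomp Require Import all_classical all_reals all_analysis.
Set Implicit Arguments. Unset Strict Implicit. Unset Printing Implicit Defensive.
Import Order.TTheory GRing.Theory Num.Theory.
Local Open Scope classical_set_scope.
Local Open Scope ring_scope.

Definition convex_plane (R : realType) (S : set (R * R)) : Prop :=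
  forall p q : R * R, S p -> S q -> forall l : R, 0 <= l -> l <= 1 ->
    S (l * p.1 + (1 - l) * q.1, l * p.2 + (1 - l) * q.2).

Definition rigid_motion (R : realType) (th : R) (t : R * R) (p : R * R) : R * R :=
  (cos th * p.1 - sin th * p.2 + t.1, sin th * p.1 + cos th * p.2 + t.2).

Definition contains_copy (R : realType) (S F : set (R * R)) : Prop :=
  exists (th : R) (t : R * R), rigid_motion th t @` F `<=` S.

Definition circle_perim1 (R : realType) : set (R * R) :=
  [set p | p.1 ^+ 2 + p.2 ^+ 2 = (1 / (2 * pi)) ^+ 2].

Definition segment_half (R : realType) : set (R * R) :=
  [set p | 0 <= p.1 <= 1 / 2 /\ p.2 = 0].

Definition rectangle (R : realType) (a b : R) : set (R * R) :=
  [set p | 0 <= p.1 <= a /\ 0 <= p.2 <= b].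

Definition area_measure (R : realType) :=
  ((@lebesgue_measure R) \x (@lebesgue_measure R))%E.

(* Lebesgue outer measure of an arbitrary subset: "area of S >= c" is stated as
   every measurable superset of S has measure >= c. *)
Definition area_at_least (R : realType) (S : set (R * R)) (c : R) : Prop :=
  forall A : set (R * R), measurable A -> S `<=` A -> (c%:E <= @area_measure R A)%E.

Arguments circle_perim1 R : clear implicits.
Arguments segment_half R : clear implicits.

(* Main.v *)
(* Work in the frame of the rectangle, in units of 10^-5: its corners are
   (+-8635, +-16365), S contains a disk of radius 15910 about a point c, and the
   segment has endpoints l + w and l - w with |w| = 25000.

   Take a convex polygon with vertices in S and edge vectors e_i, and points z_i of S.
   Then 2 area(S) >= sum_i cross(z_i, e_i). Use rectangle corners and points of the
   disk as vertices, and z_i = (1 - t_i) g_i + t_i (l +- w), where g_i is one of these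
   corners and points and the weights t_i in [0, 1] satisfy sum_i t_i e_i = 0. The
   latter makes the bound independent of l; it is linear in w and, up to a small
   quadratic error, affine in c. Hence for a box of positions of c and a cone of
   directions of w it suffices to look at corners of the box and generators of the
   cone. A tree of 199 pairs of a box and a cone, each with its polygon and weights,
   covers all positions up to symmetry, except those with c so far out that the
   rectangle and one extreme point of the disk are enough. *)
Require Import Defs.
From HB Require Import structures.
From Stdlib Require Import ZArith.
From mathcomp Require Import all_boot all_order all_algebra.
From mathcomp Require Import all_classical all_reals all_analysis.
From mathcomp Require Import ssrZ zify measurable_realfun ring lra.
Set Implicit Arguments. Unset Strict Implicit. Unset Printing Implicit Defensive.
Import Order.TTheory GRing.Theory Num.Theory.
Import numFieldNormedType.Exports.
Local Open Scope classical_set_scope.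
Local Open Scope ring_scope.

(** For a counterclockwise edge e, [cross z e] is the length of e times the component of z along the
    outer normal. So the sum is at most twice the mixed area of S and the polygon; mixed area is
    monotone and the polygon lies in S, hence the bound. As S is not assumed measurable, it is
    obtained by packing disjoint measurable triangles into S. Eliminating l matters: with it, a
    search would run over an unbounded five-dimensional space, without it only over c and the
    direction of w. But an edge between a rectangle corner and a disk point changes with c, so
    constant weights cannot balance such edges on a whole box. Two weights, on edges that do not
    depend on c, are therefore left free and solved for. They are affine in c, and their products
    with other affine terms cause the quadratic error. The goal 2000000000 is twice the area 0.1 in
    square units. The radius 15910 is slightly below 10^5 / (2 pi) = 15915.49..., which leaves room
    for a crude bound on pi. *)

Definition cross (R : pzRingType) (p q : R * R) : R := p.1 * q.2 - p.2 * q.1.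
Definition vsub (R : pzRingType) (p q : R * R) : R * R := (p.1 - q.1, p.2 - q.2).

(** * The ordered ring embedding of the integers *)

Section Embedding.
Variable R : realFieldType.

(* Locked, so that no tactic unfolds large numerals. *)
Definition zr : Z -> R := locked (fun z => (int_of_Z z)%:~R).

Lemma zrE z : zr z = (int_of_Z z)%:~R. Proof. by rewrite /zr -lock. Qed.

Lemma zr0 : zr Z0 = 0. Proof. by rewrite zrE. Qed.
Lemma zr1 : zr (Zpos xH) = 1. Proof. by rewrite zrE. Qed.
Lemma zrD a b : zr (Z.add a b) = zr a + zr b.
Proof. by rewrite !zrE -rmorphD /=; congr (_%:~R); lia. Qed.
Lemma zrN a : zr (Z.opp a) = - zr a.
Proof. by rewrite ?zrE -rmorphN /=; congr (_%:~R); lia. Qed.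
Lemma zrB a b : zr (Z.sub a b) = zr a - zr b.
Proof. by rewrite -zrN -zrD. Qed.
Lemma zrM a b : zr (Z.mul a b) = zr a * zr b.
Proof. by rewrite ?zrE -rmorphM /=; congr (_%:~R); lia. Qed.
Lemma zr_le a b : Z.leb a b -> zr a <= zr b.
Proof. by rewrite ?zrE ler_int; lia. Qed.
Lemma zr_lt a b : Z.ltb a b -> zr a < zr b.
Proof. by rewrite ?zrE ltr_int; lia. Qed.
Lemma zr_abs a : zr (Z.abs a) = `|zr a|.
Proof. by rewrite ?zrE -intr_norm; congr (_%:~R); lia. Qed.
Lemma zr_sgn a : zr (Z.sgn a) = Num.sg (zr a).
Proof.
rewrite ?zrE; case: a => [|p|p] /=; rewrite ?sgr0 //.
  by rewrite gtr0_sg // ltr0z; lia.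
by rewrite ltr0_sg ?mulrN1z// ltrz0.
Qed.

Lemma zr_pos p : 0 < zr (Zpos p).
Proof. by rewrite -zr0; apply: zr_lt. Qed.

Lemma zr_nat n : zr (Z.of_nat n) = n%:R.
Proof. by rewrite zrE pmulrn; congr (_%:~R); lia. Qed.

Definition zE := (zr0, zr1, zrD, zrN, zrB, zrM, zr_abs).

End Embedding.

(** * Lower bounds for areas *)

Section Trapezoid.
Variable R : realType.
Local Notation mu := (@lebesgue_measure R).

Lemma integral_affine (k m x0 x1 : R) : x0 < x1 ->
  (\int[mu]_(x in `[x0, x1]) (k * x + m)%:E =
   (k * (x1 ^+ 2 - x0 ^+ 2) / 2 + m * (x1 - x0))%:E)%E.
Proof.
move=> x01; pose F (x : R) := k / 2 * x ^+ 2 + m * x.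
have dF (x : R) : is_derive x 1 F (k * x + m).
  rewrite (_ : F = (k / 2) \*: (id ^+ 2) + m \*: id); last first.
    by apply/funext => y; rewrite /F !fctE.
  by apply: is_derive_eq; rewrite /GRing.scale /=; field.
have cF : continuous F.
  by move=> x; apply/differentiable_continuous/derivable1_diffP; have [] := dF x.
rewrite (@continuous_FTC2 _ _ F _ _ x01).
- by rewrite -EFinB /F; congr EFin; field.
- apply: continuous_subspaceT => x.
  by apply: cvgD; [apply: cvgM; [exact: cvg_cst|exact: cvg_id]|exact: cvg_cst].
- split; first by move=> x _; have [] := dF x.
    exact/cvg_at_right_filter/cF.
  exact/cvg_at_left_filter/cF.
- by move=> x _; rewrite derive1E; have [] := dF x.
Qed.

Definition trapezoid (x0 x1 p q r s : R) : set (R * R) :=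
  [set z | [/\ x0 < z.1, z.1 < x1, p * z.1 + q < z.2 & z.2 < r * z.1 + s]].

Lemma measurable_trapezoid x0 x1 p q r s : measurable (trapezoid x0 x1 p q r s).
Proof.
have lt_meas (f g : R * R -> R) : measurable_fun setT f -> measurable_fun setT g ->
    measurable [set z | f z < g z].
  move=> mf mg; rewrite (_ : [set _ | _] = setT `&` (fun z => f z < g z) @^-1` [set true]).
    exact: measurable_fun_ltr.
  by rewrite setTI.
have aff_meas (k m : R) : measurable_fun [set: R * R] (fun z => k * z.1 + m).
  by apply: measurable_funD => //; apply: measurable_funM => //; exact: measurable_fst.
rewrite (_ : trapezoid _ _ _ _ _ _ =
  [set z | x0 < z.1] `&` [set z | z.1 < x1] `&`
  ([set z | p * z.1 + q < z.2] `&` [set z | z.2 < r * z.1 + s])).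
  apply: measurableI; apply: measurableI; apply: lt_meas => //;
    by [exact: measurable_fst | exact: measurable_snd].
by apply/seteqP; split => z /= => [[? ? ? ?]|[[? ?] [? ?]]]; do ?split.
Qed.

(** By Fubini: the section over an abscissa is an open interval, and the second hypothesis makes its
    length the affine function itself rather than its positive part. *)
Lemma area_trapezoid x0 x1 p q r s : x0 < x1 ->
  (forall x, x0 < x < x1 -> p * x + q <= r * x + s) ->
  area_measure (trapezoid x0 x1 p q r s) =
  ((r - p) * (x1 ^+ 2 - x0 ^+ 2) / 2 + (s - q) * (x1 - x0))%:E.
Proof.
move=> x01 le; rewrite -integral_affine// /area_measure /product_measure1.
rewrite integral_itv_bndoo; last first.
  apply/measurable_EFinP.
  by apply: measurable_funD => //; apply: measurable_funM.
rewrite [RHS]integral_mkcond; apply: eq_integral => x _ /=.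
rewrite patchE; case: ifPn => [|xN].
  rewrite inE /= in_itv /= => /andP[hx0 hx1].
  rewrite (_ : xsection _ _ = `]p * x + q, r * x + s[%classic).
    rewrite lebesgue_measure_itv /= lte_fin.
    case: ltP => [_|h]; first by rewrite -EFinD; congr EFin; ring.
    have := le x; rewrite hx0 hx1 => /(_ isT) h'.
    congr EFin; lra.
  apply/seteqP; split => y; rewrite /xsection /= in_itv /= inE.
    by case=> /= _ _ -> ->.
  by move=> /andP[? ?]; split.
rewrite (_ : xsection _ _ = set0) ?measure0//.
apply/seteqP; split => y //; rewrite /xsection /= inE => -[/= h0 h1 _ _].
by move/negP: xN; apply; rewrite inE /= in_itv /= h0 h1.
Qed.

End Trapezoid.

(** * Areas of open triangles *)

Section Triangle.
Variable R : realType.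
Implicit Types a b c : R * R.

(** With strictly positive weights, triangles on the two sides of a common edge are disjoint, so
    areas add without any discussion of null sets. *)
Definition triangle a b c : set (R * R) :=
  [set p | exists x y z : R, [/\ 0 < x, 0 < y, 0 < z & x + y + z = 1] /\
     p = (x * a.1 + y * b.1 + z * c.1, x * a.2 + y * b.2 + z * c.2)].

Lemma triangle_swap23 a b c : triangle a b c = triangle a c b.
Proof.
apply/seteqP; split=> p [x [y [z [[x0 y0 z0 xyz] ->]]]]; exists x, z, y; split.
- by split=> //; rewrite -xyz; ring.
- by congr (_, _); ring.
- by split=> //; rewrite -xyz; ring.
- by congr (_, _); ring.
Qed.

Lemma triangle_swap12 a b c : triangle a b c = triangle b a c.
Proof.
apply/seteqP; split=> p [x [y [z [[x0 y0 z0 xyz] ->]]]]; exists y, x, z; split.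
- by split=> //; rewrite -xyz; ring.
- by congr (_, _); ring.
- by split=> //; rewrite -xyz; ring.
- by congr (_, _); ring.
Qed.

Local Notation area := (@area_measure R).

Lemma area0 : area set0 = 0%:E.
Proof. by rewrite /area_measure measure0. Qed.

Lemma areaU (A B : set (R * R)) : measurable A -> measurable B ->
  A `&` B = set0 -> area (A `|` B) = (area A + area B)%E.
Proof. by move=> mA mB AB; rewrite /area_measure measureU. Qed.

(** Only lower bounds for areas are wanted, so a measurable subset of the right area can stand in
    for a triangle; for a degenerate triangle it may be empty. *)
Definition fills (T X : set (R * R)) (v : R) : Prop :=
  [/\ measurable T, T `<=` X & area_measure T = v%:E].

(** The last clause serves the cutting of a general triangle: a piece of zero width lies on the
    boundary of the open triangle, so its filling set has to be empty. *)
Lemma vertical_triangle a (x u v : R) :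
  exists T, fills T (triangle a (x, u) (x, v)) (`|x - a.1| * `|v - u| / 2)
    /\ (a.1 = x -> T = set0).
Proof.
wlog uv : u v / u <= v.
  move=> H; have [|/ltW] := leP u v; first exact: H.
  by move=> /H [T [HT T0]]; exists T; rewrite triangle_swap23 (distrC v u).
rewrite (ger0_norm (_ : 0 <= v - u)) ?subr_ge0//.
have [->|uv'] := eqVneq u v.
  exists set0; split=> //; split=> //.
  by rewrite area0 subrr mulr0 mul0r.
have {}uv : u < v by rewrite lt_neqAle uv'.
have [E|d0] := eqVneq (x - a.1) 0.
  exists set0; split=> //; split=> //.
  by rewrite area0 E normr0 !mul0r.
set d := x - a.1 in d0 *.
(* Slopes of the lines from [a] to [(x, u)] and [(x, v)]; the same trapezoid description works for
   both signs of [d]. *)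
pose p := (u - a.2) / d; pose r := (v - a.2) / d.
pose x0 := Num.min a.1 x; pose x1 := Num.max a.1 x.
exists (trapezoid x0 x1 p (a.2 - p * a.1) r (a.2 - r * a.1)); split; last first.
  by move=> E; move: d0; rewrite /d E subrr eqxx.
have rp : (r - p) * d = v - u by rewrite /r /p -mulrBl divfK//; ring.
split.
- exact: measurable_trapezoid.
- move=> z [h0 h1 h2 h3].
  (* [k] is the relative horizontal distance from [a]. Together with the height [m] below, it gives
     the barycentric weights [1 - k], [k - m], [m]. *)
  pose k := (z.1 - a.1) / d.
  have kd : k * d = z.1 - a.1 by rewrite /k divfK.
  have k01 : 0 < k < 1.
    rewrite /k; have [dneg|dpos] := ltP d 0.
      have ax : x < a.1 by move: dneg; rewrite /d; lra.
      move: h0 h1; rewrite /x0 /x1 min_r ?max_l ?(ltW ax)// => h0 h1.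
      by rewrite ltr_ndivlMr// ltr_ndivrMr// mul0r mul1r /d; apply/andP; split; lra.
    have {}dpos : 0 < d by rewrite lt_neqAle eq_sym d0.
    have ax : a.1 < x by move: dpos; rewrite /d; lra.
    move: h0 h1; rewrite /x0 /x1 min_l ?max_r ?(ltW ax)// => h0 h1.
    by rewrite ltr_pdivlMr// ltr_pdivrMr// mul0r mul1r /d; apply/andP; split; lra.
  move: k01 => /andP[k0 k1].
  have pk : p * (z.1 - a.1) = k * (u - a.2) by rewrite /p /k; field.
  have rk : r * (z.1 - a.1) = k * (v - a.2) by rewrite /r /k; field.
  have l1 : k * (u - a.2) < z.2 - a.2 by rewrite -pk; move: h2; lra.
  have l2 : z.2 - a.2 < k * (v - a.2) by rewrite -rk; move: h3; lra.
  have vu : 0 < v - u by rewrite subr_gt0.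
  pose m := (z.2 - a.2 - k * (u - a.2)) / (v - u).
  have mE : m * (v - u) = z.2 - a.2 - k * (u - a.2) by rewrite /m divfK// gt_eqF.
  have m0 : 0 < m by rewrite divr_gt0// subr_gt0.
  have mk : m < k by rewrite ltr_pdivrMr//; move: l2; lra.
  exists (1 - k), (k - m), m; split; first by split; lra.
  rewrite [LHS]surjective_pairing; congr (_, _) => /=.
    rewrite (_ : _ + _ = a.1 + k * d); last by rewrite /d; ring.
    by rewrite kd; ring.
  rewrite (_ : _ + _ = a.2 + k * (u - a.2) + m * (v - u)); last by ring.
  by rewrite mE; ring.
- have [dneg|dpos] := ltP d 0.
    have ax : x < a.1 by move: dneg; rewrite /d; lra.
    rewrite /x0 /x1 min_r ?max_l ?(ltW ax)// area_trapezoid//.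
      by rewrite (ltr0_norm dneg) -rp; congr EFin; rewrite /d; field.
    move=> y /andP[y0 y1].
    have : 0 < (v - u) / d * (y - a.1).
      rewrite nmulr_rgt0; first by rewrite subr_lt0.
      by rewrite pmulr_rlt0 ?invr_lt0// subr_gt0.
    by rewrite -rp mulfK//; lra.
  have {}dpos : 0 < d by rewrite lt_neqAle eq_sym d0.
  have ax : a.1 < x by move: dpos; rewrite /d; lra.
  rewrite /x0 /x1 min_l ?max_r ?(ltW ax)// area_trapezoid//.
    by rewrite (gtr0_norm dpos) -rp; congr EFin; rewrite /d; field.
  move=> y /andP[y0 y1].
  have : 0 < (v - u) / d * (y - a.1).
    by rewrite mulr_gt0 ?divr_gt0// subr_gt0.
  by rewrite -rp mulfK//; lra.
Qed.

(** After sorting by abscissa, the vertical line through the middle vertex [b] meets the side from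
    [a] to [c] at height [m] and cuts the triangle into two with a vertical side. *)
Lemma triangle_fill a b c :
  exists T, fills T (triangle a b c) (`|cross (vsub b a) (vsub c a)| / 2).
Proof.
wlog ab : a b c / a.1 <= b.1.
  move=> H; have [|/ltW] := leP a.1 b.1; first exact: H.
  move=> /(H b a c); rewrite triangle_swap12.
  rewrite (_ : cross _ _ = - cross (vsub b a) (vsub c a)) ?normrN//.
  by rewrite /cross /vsub /=; ring.
wlog ac : a b c ab / a.1 <= c.1.
  move=> H; have [|/ltW ca] := leP a.1 c.1; first exact: H.
  have [|T HT] := H c a b ca; first exact: le_trans ca ab.
  exists T; move: HT; rewrite triangle_swap12 triangle_swap23.
  rewrite (_ : cross _ _ = cross (vsub b a) (vsub c a))//.
  by rewrite /cross /vsub /=; ring.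
wlog bc : b c ab ac / b.1 <= c.1.
  move=> H; have [|/ltW cb] := leP b.1 c.1; first exact: H.
  have [T HT] := H c b ac ab cb.
  exists T; move: HT; rewrite triangle_swap23.
  rewrite (_ : cross _ _ = - cross (vsub b a) (vsub c a)) ?normrN//.
  by rewrite /cross /vsub /=; ring.
have [E|L0] := eqVneq (c.1 - a.1) 0.
  exists set0; split=> //; rewrite area0 (_ : cross _ _ = 0) ?normr0 ?mul0r//.
  rewrite /cross /vsub /= E (_ : b.1 = a.1) ?subrr ?mul0r ?mulr0 ?subrr//.
  by move: E ab bc; lra.
have L : 0 < c.1 - a.1 by rewrite lt_neqAle eq_sym L0 subr_ge0.
pose t := (b.1 - a.1) / (c.1 - a.1).
have tL : t * (c.1 - a.1) = b.1 - a.1 by rewrite /t divfK.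
pose m := a.2 + t * (c.2 - a.2).
have [T1 [[mT1 sT1 aT1] z1]] := vertical_triangle a b.1 b.2 m.
have [T2 [[mT2 sT2 aT2] z2]] := vertical_triangle c b.1 b.2 m.
have t0 : 0 <= t by rewrite divr_ge0 ?subr_ge0.
have t1 : t <= 1 by rewrite ler_pdivrMr// mul1r lerD2r.
exists (T1 `|` T2); split.
- exact: measurableU.
- rewrite subUset; split=> p.
    have [E|ne] := eqVneq a.1 b.1; first by rewrite z1.
    move=> /sT1 [x [y [z [[x0 y0 z0 xyz] ->]]]].
    have t0' : 0 < t by rewrite divr_gt0// subr_gt0 lt_neqAle ne.
    exists (x + z * (1 - t)), y, (z * t); split.
      split=> //; [|exact: mulr_gt0|by move: xyz; lra].
      by rewrite ltr_pwDl// mulr_ge0 ?subr_ge0// ltW.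
    congr (_, _) => /=; last by rewrite /m; ring.
    rewrite (_ : z * b.1 = z * (a.1 + t * (c.1 - a.1))); first by ring.
    by rewrite tL; ring.
  have [E|ne] := eqVneq c.1 b.1; first by rewrite z2.
  move=> /sT2 [x [y [z [[x0 y0 z0 xyz] ->]]]].
  have t1' : t < 1.
    by rewrite ltr_pdivrMr// mul1r ltrD2r lt_neqAle eq_sym ne.
  exists (z * (1 - t)), y, (x + z * t); split.
    split=> //; [by rewrite mulr_gt0 ?subr_gt0| |by move: xyz; lra].
    by rewrite ltr_pwDl// mulr_ge0// ltW.
  congr (_, _) => /=; last by rewrite /m; ring.
  rewrite (_ : z * b.1 = z * (a.1 + t * (c.1 - a.1))); first by ring.
  by rewrite tL; ring.
- rewrite areaU//; last first.
    apply/seteqP; split=> // p [p1 p2].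
    have [E|ne1] := eqVneq a.1 b.1; first by rewrite -(z1 E).
    have [E|ne2] := eqVneq c.1 b.1; first by rewrite -(z2 E).
    have h1 : p.1 < b.1.
      move: (sT1 _ p1) => [x [y [z [[x0 y0 z0 xyz] ->]]]] /=.
      have : 0 < x * (b.1 - a.1) by rewrite mulr_gt0 ?subr_gt0// lt_neqAle ne1.
      have -> : x = 1 - y - z by lra.
      lra.
    have h2 : b.1 < p.1.
      move: (sT2 _ p2) => [x [y [z [[x0 y0 z0 xyz] ->]]]] /=.
      have : 0 < x * (c.1 - b.1) by rewrite mulr_gt0 ?subr_gt0// lt_neqAle eq_sym ne2.
      have -> : x = 1 - y - z by lra.
      lra.
    by move: (lt_trans h1 h2); rewrite ltxx.
  rewrite aT1 aT2 -EFinD; congr EFin.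
  rewrite (ger0_norm (_ : 0 <= b.1 - a.1)) ?subr_ge0//.
  rewrite (distrC b.1) (ger0_norm (_ : 0 <= c.1 - b.1)) ?subr_ge0//.
  rewrite (_ : cross _ _ = (m - b.2) * (c.1 - a.1)).
    by rewrite normrM (gtr0_norm L); field.
  rewrite /m /cross /vsub /= [RHS](_ : _ = (a.2 - b.2) * (c.1 - a.1) +
    (t * (c.1 - a.1)) * (c.2 - a.2)); last by ring.
  by rewrite tL; ring.
Qed.

End Triangle.

(** * Convex polygons with attached points *)

Section PolygonData.
Variable R : realType.

(** Consecutive edges share a vertex, which lies on both lines. Hence strictness is asked, through
    the sum, of at least one end of [j] only. *)
Definition edge_left (i j : (R * R) * (R * R)) : bool :=
  let e := vsub i.2 i.1 in
  [&& 0 <= cross e (vsub j.1 i.1), 0 <= cross e (vsub j.2 i.1) &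
      0 < cross e (vsub j.1 i.1) + cross e (vsub j.2 i.1)].

(* The pairs i.1 are the oriented edges of a convex polygon around o with vertices
   in S, and i.2 is a point of S attached to the edge. *)
Definition mixed_area_ge (S : set (R * R)) (v : R) : Prop :=
  exists (s : seq ((R * R) * (R * R) * (R * R))) (o : R * R),
  [/\ S o, forall i, i \in s -> [/\ S i.1.1, S i.1.2 & S i.2],
      all (fun i => 0 < cross (vsub i.1 o) (vsub i.2 o)) (map fst s) &
      pairwise (fun i j => edge_left i j && edge_left j i) (map fst s)]
  /\ [/\ \sum_(i <- s) (i.1.2.1 - i.1.1.1) = 0, \sum_(i <- s) (i.1.2.2 - i.1.1.2) = 0 &
      v <= \sum_(i <- s) cross i.2 (vsub i.1.2 i.1.1)].

End PolygonData.

(** * The area bound for a convex set, in affine coordinates *)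

Section MixedArea.
Variable R : realType.
Local Notation area := (@area_measure R).
Variables (t u v : R * R).
Hypothesis uv : cross u v != 0.

(** The map from the frame of the certificate to the plane: origin [t], images [u] and [v] of the
    unit vectors, determinant [cross u v], which is negative if the frame is reflected. *)
Definition affine (p : R * R) : R * R :=
  (t.1 + u.1 * p.1 + v.1 * p.2, t.2 + u.2 * p.1 + v.2 * p.2).

Lemma affine_inj : injective affine.
Proof.
move=> p q [e1 e2].
have E (x y : R) : cross u v * x = cross u v * y -> x = y by apply: mulfI.
rewrite [p]surjective_pairing [q]surjective_pairing; congr (_, _); apply: E; rewrite /cross.
  have : (u.1 * p.1 + v.1 * p.2) * v.2 - (u.2 * p.1 + v.2 * p.2) * v.1 =
         (u.1 * q.1 + v.1 * q.2) * v.2 - (u.2 * q.1 + v.2 * q.2) * v.1.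
    by congr (_ * _ - _ * _); lra.
  lra.
have : u.1 * (u.2 * p.1 + v.2 * p.2) - u.2 * (u.1 * p.1 + v.1 * p.2) =
       u.1 * (u.2 * q.1 + v.2 * q.2) - u.2 * (u.1 * q.1 + v.1 * q.2).
  by congr (_ * _ - _ * _); lra.
lra.
Qed.

Lemma preimage_convex S : convex_plane S -> convex_plane (affine @^-1` S).
Proof.
move=> cS p q Sp Sq l l0 l1 /=.
have := cS _ _ Sp Sq l l0 l1; rewrite /affine /=.
by congr (S (_, _)); ring.
Qed.

Lemma affine_triangle_fill a b c : exists T,
  fills T (affine @` triangle a b c) (`|cross u v| * `|cross (vsub b a) (vsub c a)| / 2).
Proof.
have [T [mT sT aT]] := triangle_fill (affine a) (affine b) (affine c).
exists T; split=> //.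
  move=> p /sT [x [y [z [[x0 y0 z0 xyz] ->]]]].
  exists (x * a.1 + y * b.1 + z * c.1, x * a.2 + y * b.2 + z * c.2).
    by exists x, y, z.
  rewrite /affine /=; congr (_, _).
    by rewrite -[in LHS](mulr1 t.1) -xyz; ring.
  by rewrite -[in LHS](mulr1 t.2) -xyz; ring.
rewrite aT; congr EFin; rewrite -normrM; congr (`|_| / 2).
by rewrite /cross /vsub /affine /=; ring.
Qed.

Lemma exists_max (T : eqType) (f : T -> R) (s : seq T) x : x \in s ->
  exists2 y, y \in s & forall z, z \in s -> f z <= f y.
Proof.
elim: s x => // a s IH x _; case: s IH => [|b s] IH.
  by exists a => [|z]; rewrite inE // => /eqP ->.
have [y ys yM] := IH b (mem_head _ _).
have [le|lt] := leP (f a) (f y).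
  by exists y => [|z]; rewrite inE ?ys ?orbT// => /orP[/eqP ->|/yM].
exists a => [|z]; first exact: mem_head.
by rewrite inE => /orP[/eqP ->//|/yM h]; exact: le_trans h (ltW lt).
Qed.

Lemma triangle_sub (S : set (R * R)) a b c : convex_plane S ->
  S a -> S b -> S c -> triangle a b c `<=` S.
Proof.
move=> cS Sa Sb Sc p [x [y [z [[x0 y0 z0 xyz] ->]]]].
have yz : 0 < y + z by exact: addr_gt0.
have yz0 : y + z != 0 by rewrite gt_eqF.
have := cS b c Sb Sc (y / (y + z)); rewrite divr_ge0 ?(ltW yz) ?(ltW y0)//.
rewrite ler_pdivrMr// mul1r lerDl (ltW z0) => /(_ isT isT).
move=> /(cS a _ Sa) /(_ x (ltW x0)) /=.
have -> : x <= 1 by lra.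
move=> /(_ isT); congr (S (_, _)); rewrite (_ : 1 - x = y + z); try lra; field.
all: by [].
Qed.

(* Put on each edge e the triangle whose apex is the point q of a finite subset of S
   that is farthest beyond e. By the choice of the apices these triangles overlap
   neither each other nor the triangles joining the edges to the interior point o;
   since the edge vectors add up to 0, twice the total area is the sum of the
   cross q e, hence at least the sum of the cross z e. *)
Lemma area_mixed_ge S A w : convex_plane S ->
  mixed_area_ge (affine @^-1` S) w -> measurable A -> S `<=` A ->
  ((`|cross u v| * w / 2)%:E <= area A)%E.
Proof.
move=> cS [s] [q0] [[So Ss pos pw] [sum1 sum2 le_w]] mA SA.
have cS' := preimage_convex cS.
set S' := affine @^-1` S in So Ss cS'.
pose n := size s; pose x0 := (q0, q0, q0).
pose it (i : 'I_n) := nth x0 s i.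
pose e i := vsub (it i).1.2 (it i).1.1.
(* Twice the signed area of the triangle on edge [i] with apex [x]: positive on the side of [q0],
   negative beyond the edge. *)
pose L i x := cross (e i) (vsub x (it i).1.1).
have its i : it i \in s by rewrite mem_nth.
have Sit i := Ss _ (its i).
(* The attached points are candidates for the apex so that [cross z e] is at most [cross q e]; the
   starting points of the edges are candidates so that [L i (q i) <= 0]. *)
pose P := q0 :: map snd s ++ map (fun i => i.1.1) s.
have PS p : p \in P -> S' p.
  rewrite inE mem_cat => /or3P[/eqP ->//|/mapP[i /Ss[_ _ ?] ->//]|/mapP[i /Ss[? _ _] ->//]].
have /choice[q qP] : forall i, exists q, q \in P /\
    forall p, p \in P -> cross p (e i) <= cross q (e i).
  move=> i; have [y yP yM] := exists_max (fun p => cross p (e i)) (mem_head q0 _ : q0 \in P).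
  by exists y.
have LE i x : L i x = cross (it i).1.1 (e i) - cross x (e i).
  by rewrite /L /cross /vsub /=; ring.
have Lq i j : L i (q i) <= L i (q j).
  by rewrite !LE lerD2l lerN2; apply: (qP i).2; exact: (qP j).1.
have Lqm i : L i (q i) <= 0.
  rewrite LE subr_le0; apply: (qP i).2; rewrite inE mem_cat.
  by apply/or3P/Or33/mapP; exists (it i).
have L0 i : 0 < L i q0.
  have := allP pos _ (map_f fst (its i)).
  by congr (0 < _); rewrite /L /cross /vsub /=; ring.
have Lm i j : i != j -> [/\ 0 <= L i (it j).1.1, 0 <= L i (it j).1.2 &
    0 < L i (it j).1.1 + L i (it j).1.2].
  have nthE (k : 'I_n) : nth x0.1 (map fst s) k = (it k).1 by rewrite (nth_map x0).
  move/pairwiseP: pw => /(_ x0.1) pw ij.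
  have := @pw i j; have := @pw j i; rewrite !inE size_map !ltn_ord !nthE.
  case: (ltngtP (i : nat) j) => [_ _|_ + _|/val_inj E]; last by rewrite E eqxx in ij.
    by move=> /(_ isT isT isT) /andP[/and3P[]].
  by move=> /(_ isT isT isT) /andP[_ /and3P[]].
(* [k] is the barycentric weight of the apex. [L j] vanishes on edge [j], whereas for every other
   [i] the two ends of edge [j] contribute a positive amount to [L i]. *)
have tri_L a j x : triangle a (it j).1.1 (it j).1.2 x ->
    exists2 k, 0 < k & L j x = k * L j a /\ forall i, i != j -> k * L i a < L i x.
  move=> [k [y [z [[k0 y0 z0 kyz] ->]]]]; exists k => //.
  have aff i : L i (k * a.1 + y * (it j).1.1.1 + z * (it j).1.2.1,
      k * a.2 + y * (it j).1.1.2 + z * (it j).1.2.2) =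
      k * L i a + y * L i (it j).1.1 + z * L i (it j).1.2.
    by rewrite (_ : k = 1 - y - z); [rewrite /L /cross /vsub /=; ring|lra].
  split=> [|i ij]; rewrite aff.
    by rewrite /L /e /cross /vsub /=; ring.
  have [h1 h2 h3] := Lm i j ij.
  rewrite -addrA ltrDl.
  have [E|ne] := eqVneq (L i (it j).1.1) 0.
    by move: h3; rewrite E add0r mulr0 add0r => h3; exact: mulr_gt0.
  rewrite ltr_pwDl//; first by rewrite mulr_gt0// lt_neqAle eq_sym ne.
  by rewrite mulr_ge0// ltW.
(* If the apex lies on the line of the edge, there is no triangle to add and [X i] is empty. *)
pose X i : set (R * R) :=
  [set p | L i (q i) < 0 /\ (affine @` triangle (q i) (it i).1.1 (it i).1.2) p].
pose Y i : set (R * R) := affine @` triangle q0 (it i).1.1 (it i).1.2.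
pose d := `|cross u v|.
have /choice[U UP] : forall i, exists T, fills T (X i) (d * (- L i (q i)) / 2).
  move=> i; have [h|h] := ltP (L i (q i)) 0; last first.
    have E : L i (q i) = 0 by apply/eqP; rewrite eq_le h Lqm.
    by exists set0; split=> //; rewrite area0 E oppr0 mulr0 mul0r.
  have [T [mT sT aT]] := affine_triangle_fill (q i) (it i).1.1 (it i).1.2.
  exists T; split=> // [p /sT //|]; rewrite aT; congr (_ * _ / 2)%:E.
  rewrite -normrN -(gtr0_norm (_ : 0 < - L i (q i))) ?oppr_gt0//.
  by congr (`|_|); rewrite /L /e /cross /vsub /=; ring.
have /choice[V VP] : forall i, exists T, fills T (Y i) (d * L i q0 / 2).
  move=> i; have [T [mT sT aT]] := affine_triangle_fill q0 (it i).1.1 (it i).1.2.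
  exists T; split=> //; rewrite aT; congr (_ * _ / 2)%:E.
  rewrite -(gtr0_norm (L0 i)).
  by congr (`|_|); rewrite /L /e /cross /vsub /=; ring.
have XS i : X i `<=` S.
  move=> p [_ [x xt <-]]; have [? ? _] := Sit i.
  by apply: (triangle_sub cS' _ _ _ xt) => //; apply: PS; exact: (qP i).1.
have YS i : Y i `<=` S.
  by move=> p [x xt <-]; have [? ? _] := Sit i; exact: (triangle_sub cS' _ _ _ xt).
(* Let a common point have apex weights [k] in [X i] and [k'] in [X j]. Since [q i] is at least as
   far beyond edge [i] as [q j], comparing the values of [L i] forces [k < k']; comparing [L j]
   forces [k' < k]. *)
have tU : trivIset setT U.
  apply/trivIsetP => i j _ _ ij; apply/seteqP; split=> // p [Ui Uj].
  have [_ /(_ _ Ui)[ni [x xt px]] _] := UP i.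
  have [_ /(_ _ Uj)[nj [y yt py]] _] := UP j.
  move: yt; rewrite (affine_inj (etrans py (esym px))) => yt.
  have [k k0 [E1 /(_ j)]] := tri_L _ _ _ xt; rewrite eq_sym => /(_ ij) E2.
  have [k' k'0 [E3 /(_ i ij) E4]] := tri_L _ _ _ yt.
  have := Lq i j; have := Lq j i => h1 h2.
  have kk : k < k'.
    by rewrite -(ltr_nM2r ni) -E1; apply: le_lt_trans E4; rewrite ler_wpM2l// ltW.
  have : k' < k.
    by rewrite -(ltr_nM2r nj) -E3; apply: le_lt_trans E2; rewrite ler_wpM2l// ltW.
  by move=> /(lt_trans kk); rewrite ltxx.
have tV : trivIset setT V.
  apply/trivIsetP => i j _ _ ij; apply/seteqP; split=> // p [Vi Vj].
  have [_ /(_ _ Vi)[x xt px] _] := VP i.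
  have [_ /(_ _ Vj)[y yt py] _] := VP j.
  move: yt; rewrite (affine_inj (etrans py (esym px))) => yt.
  have [k k0 [E1 /(_ j)]] := tri_L _ _ _ xt; rewrite eq_sym => /(_ ij) E2.
  have [k' k'0 [E3 /(_ i ij) E4]] := tri_L _ _ _ yt.
  move: E2 E4; rewrite E1 E3 !ltr_pM2r// => h1 h2.
  by have := lt_trans h1 h2; rewrite ltxx.
pose UU := \big[setU/set0]_(i < n) U i; pose VV := \big[setU/set0]_(i < n) V i.
have mU i : measurable (U i) by have [] := UP i.
have mV i : measurable (V i) by have [] := VP i.
have mUU : measurable UU by exact: bigsetU_measurable.
have mVV : measurable VV by exact: bigsetU_measurable.
(* Points of [X i] have [L i] negative, while [L i] is positive on every triangle with apex [q0]. *)
have UV : UU `&` VV = set0.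
  apply/seteqP; split=> // p []; rewrite /UU /VV -!bigcup_seq => -[i _ Ui] [j _ Vj].
  have [_ /(_ _ Ui)[ni [x xt px]] _] := UP i.
  have [_ /(_ _ Vj)[y yt py] _] := VP j.
  move: yt; rewrite (affine_inj (etrans py (esym px))) => yt.
  have [k k0 [E1 _]] := tri_L _ _ _ xt.
  have [k' k'0 [E3 E4]] := tri_L _ _ _ yt.
  have h1 : L i x < 0 by rewrite E1 pmulr_rlt0.
  have h2 : 0 < L i x.
    have [ij|ij] := eqVneq i j; first by rewrite ij E3 mulr_gt0.
    by apply: lt_trans (E4 i ij); rewrite mulr_gt0.
  by have := lt_trans h1 h2; rewrite ltxx.
have sub : UU `|` VV `<=` A.
  rewrite subUset /UU /VV -!bigcup_seq; split=> p [i _].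
    by move=> Ui; apply: SA; apply: (XS i); have [_ + _] := UP i; apply.
  by move=> Vi; apply: SA; apply: (YS i); have [_ + _] := VP i; apply.
apply: (@le_trans _ _ (area (UU `|` VV))); last first.
  by rewrite /area_measure le_measure// inE//; exact: measurableU.
rewrite areaU// /area_measure !measure_bigsetU_ord//.
rewrite (eq_bigr (fun i => (d * (- L i (q i)) / 2)%:E)); last by move=> i _; have [] := UP i.
rewrite (eq_bigr (fun i => (d * L i q0 / 2)%:E) (F1 := fun i => _ (V i)));
  last by move=> i _; have [] := VP i.
rewrite !sumEFin -EFinD lee_fin -big_split /=.
rewrite (eq_bigr (fun i => d / 2 * (cross (q i) (e i) - cross q0 (e i)))); last first.
  by move=> i _; rewrite !LE; ring.
rewrite -mulr_sumr mulrAC ler_wpM2l// ?divr_ge0//.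
(* The total area still contains [q0], but its contribution is [cross q0] of the sum of the edge
   vectors, which is 0. *)
have q0E : \sum_(i < n) cross q0 (e i) = 0.
  move: sum1 sum2; rewrite !(big_nth x0) !big_mkord => sum1 sum2.
  by rewrite /cross sumrB -!mulr_sumr sum1 sum2 !mulr0 subrr.
have -> : \sum_(i < n) (cross (q i) (e i) - cross q0 (e i)) = \sum_(i < n) cross (q i) (e i).
  by rewrite [LHS]sumrB q0E subr0.
apply: le_trans le_w _; rewrite (big_nth x0) big_mkord.
apply: ler_sum => i _; apply: (qP i).2.
by rewrite inE mem_cat; apply/or3P/Or32/mapP; exists (it i).
Qed.

End MixedArea.

(** * The certificate and its checker *)

Section Checker.
Local Open Scope Z_scope.

(* Let d = (d1, d2) be the displacement of the centre of the disk from the centre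
   of the current box. A triple (a, b, k) stands for the affine function
   a + b d1 + k d2 and also for the point (a + k d1, b + k d2), which is fixed
   (k = 0) or moves with the disk (k = 1). *)
Definition aform : Type := (Z * Z * Z)%type.

Definition fadd (p q : aform) : aform :=
  (p.1.1 + q.1.1, p.1.2 + q.1.2, p.2 + q.2).
Definition fscale (a : Z) (p : aform) : aform := (a * p.1.1, a * p.1.2, a * p.2).
Definition fsub (p q : aform) : aform := fadd p (fscale (-1) q).
Definition fsum (s : seq aform) : aform := foldr fadd (0, 0, 0) s.

(* As a function of d, the product is affine only if the quadratic terms cancel, which
   they do because both coordinates of a point share the coefficient k. *)
Definition fcross (p q : aform) : aform :=
  (p.1.1 * q.1.2 - p.1.2 * q.1.1,
   p.2 * q.1.2 - q.2 * p.1.2, q.2 * p.1.1 - p.2 * q.1.1).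

(** The maximum of the linear part over the box with half-sides [h], so [fmin] and [fmax] are the
    exact extremes of an affine function there. *)
Definition fmag (h : Z * Z) (f : aform) : Z :=
  Z.abs f.1.2 * h.1 + Z.abs f.2 * h.2.
Definition fmin (h : Z * Z) (f : aform) : Z := f.1.1 - fmag h f.
Definition fmax (h : Z * Z) (f : aform) : Z := f.1.1 + fmag h f.

(* The product of two affine functions without its quadratic part. *)
Definition fmul1 (f g : aform) : aform :=
  (f.1.1 * g.1.1, f.1.1 * g.1.2 + f.1.2 * g.1.1, f.1.1 * g.2 + f.2 * g.1.1).

(* An entry (i, g, k) describes the edge e from the i-th point to the start of the next
   entry's edge, paired with z = (1 - t) p_g + t (l + sgn(k) w), where t = |k| / 1000. *)
Definition entry : Type := (Z * Z * Z)%type.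

(* The start, the edge vector, the point p_g and the weight k of an entry. *)
Definition item : Type := (aform * aform * aform * Z)%type.
Definition im (i : item) : aform := i.1.1.1.
Definition ie (i : item) : aform := i.1.1.2.
Definition ig (i : item) : aform := i.1.2.
Definition iw (i : item) : Z := i.2.

(** An index out of range is harmless: the default is the centre of the rectangle, which also
    belongs to S. *)
Fixpoint znth (s : seq aform) (i : Z) : aform :=
  if s is p :: s' then if i =? 0 then p else znth s' (i - 1) else (0, 0, 0).

(** Disk points are stored relative to the centre of the disk. Adding the centre [c] of the box
    leaves only the displacement d as a variable. *)
Definition vertex (pts : seq aform) (c : Z * Z) (i : Z) : aform :=
  let p := znth pts i in (p.1.1 + p.2 * c.1, p.1.2 + p.2 * c.2, p.2).

Definition mkitem pts c (x y : entry) : item :=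
  let v := vertex pts c x.1.1 in
  (v, fsub (vertex pts c y.1.1) v, vertex pts c x.1.2, x.2).

Fixpoint mkitems pts c (s : seq entry) (nxt : entry) : seq item :=
  if s is x :: s' then mkitem pts c x (head nxt s') :: mkitems pts c s' nxt
  else [::].

Definition left_of h (i j : item) : bool :=
  let d := fsub (im j) (im i) in
  let a := fmin h (fcross (ie i) d) in
  let b := fmin h (fcross (ie i) (fadd d (ie j))) in
  [&& 0 <=? a, 0 <=? b & 0 <? a + b].

Definition convex_ok h (s : seq item) : bool :=
  all (fun i => 0 <? fmin h (fcross (im i) (ie i))) s &&
  pairwise (fun i j => left_of h i j && left_of h j i) s.

Definition ibase (i : item) : aform := fcross (ig i) (ie i).

(** The part of the lower bound that is linear in w, times 1000 D. Taking only the constant part of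
    [fcross u (ie A)] loses nothing, because [leaf_ok] demands that the edges A and B do not move
    with the disk. *)
Definition wform D W TA TB (A B : item) (w : Z * Z) : aform :=
  let u := (w.1, w.2, 0) in
  fsum [:: fscale D (fcross u W);
           fscale (Z.sgn (iw A) * (fcross u (ie A)).1.1) TA;
           fscale (Z.sgn (iw B) * (fcross u (ie B)).1.1) TB].

(* Only the sign of the weight k counts for the two edges A and B: their values t_A and
   t_B are the functions of d for which the sum of all t e vanishes, that is, by
   Cramer's rule, TA / (1000 D) and TB / (1000 D). All quantities are multiplied by
   1000 D, and Q bounds the quadratic parts dropped by fmul1. *)
Definition leaf_ok (goal : Z) (h w1 w2 : Z * Z) (A B : item) (N1 N2 : seq item) : bool :=
  let N := N1 ++ N2 in
  let all_ := A :: N1 ++ B :: N2 in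
  let G := fsum (map ibase all_) in
  let H := fsum (map (fun i => fscale (Z.abs (iw i)) (ibase i)) N) in
  let V := fsum (map (fun i => fscale (Z.abs (iw i)) (ie i)) N) in
  let W := fsum (map (fun i => fscale (iw i) (ie i)) N) in
  let D := (fcross (ie A) (ie B)).1.1 in
  let TA := fcross (ie B) V in
  let TB := fcross V (ie A) in
  let P := fsum [:: fscale (1000 * D) G; fscale (- D) H;
                    fscale (-1) (fmul1 TA (ibase A)); fscale (-1) (fmul1 TB (ibase B))] in
  let Q := fmag h TA * fmag h (ibase A) + fmag h TB * fmag h (ibase B) in
  let good w :=
    let F := wform D W TA TB A B w in
    (0 <=? fmin h F) && (goal * (1000 * D) + Q <=? fmin h (fadd P F)) in
  [&& convex_ok h all_, all (fun i => Z.abs (iw i) <=? 1000) N,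
      (ie A).2 =? 0, (ie B).2 =? 0, 0 <? D,
      0 <=? fmin h TA, fmax h TA <=? 1000 * D,
      0 <=? fmin h TB, fmax h TB <=? 1000 * D,
      good w1 & good w2].

(* The position of the centre ranges over the box c +- h and the direction of w over
   the cone between w1 and w2. SplitX and SplitY halve the box, SplitW x y cuts the
   cone along (x, y). *)
Inductive tree :=
  | SplitX of tree & tree
  | SplitY of tree & tree
  | SplitW of Z & Z & tree & tree
  | Leaf of entry & seq entry & entry & seq entry.

(** Rounding up makes the two halves cover a box with an odd half-side. *)
Definition halfZ (h : Z) := (h + 1) / 2.

Definition wcross (v w : Z * Z) : Z := v.1 * w.2 - v.2 * w.1.

Fixpoint tree_ok goal pts (c h w1 w2 : Z * Z) (t : tree) : bool :=
  match t with
  | SplitX t1 t2 =>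
      let q := halfZ h.1 in
      tree_ok goal pts (c.1 - q, c.2) (q, h.2) w1 w2 t1 &&
      tree_ok goal pts (c.1 + q, c.2) (q, h.2) w1 w2 t2
  | SplitY t1 t2 =>
      let q := halfZ h.2 in
      tree_ok goal pts (c.1, c.2 - q) (h.1, q) w1 w2 t1 &&
      tree_ok goal pts (c.1, c.2 + q) (h.1, q) w1 w2 t2
  | SplitW x y t1 t2 =>
      [&& x * x + y * y <=? 625000000,
          tree_ok goal pts c h w1 (x, y) t1 & tree_ok goal pts c h (x, y) w2 t2]
  | Leaf a s1 b s2 =>
      (0 <? wcross w1 w2) &&
      leaf_ok goal h w1 w2 (mkitem pts c a (head b s1)) (mkitem pts c b (head a s2))
        (mkitems pts c s1 b) (mkitems pts c s2 a)
  end.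

(** The points at 0, 5, ..., 85 degrees on the circle of radius 15910, with coordinates rounded
    towards 0 so that they stay in the disk. *)
Definition quarter : seq (Z * Z) :=
  [:: (15910, 0); (15849, 1386); (15668, 2762); (15367, 4117); (14950, 5441); (14419, 6723);
    (13778, 7955); (13032, 9125); (12187, 10226); (11250, 11250); (10226, 12187); (9125, 13032);
      (7955, 13778); (6723, 14419); (5441, 14950); (4117, 15367); (2762, 15668); (1386, 15849)].

Definition rot (p : Z * Z) : Z * Z := (- p.2, p.1).

(** Indices 0 to 3 are the rectangle corners in counterclockwise order; index 4 + j is the disk
    point at 5 j degrees. *)
Definition points : seq aform :=
  [:: (8635, 16365, 0); (-8635, 16365, 0); (-8635, -16365, 0); (8635, -16365, 0)] ++
  map (fun p => (p.1, p.2, 1))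
    (quarter ++ map rot quarter ++ map rot (map rot quarter) ++
     map rot (map rot (map rot quarter))).

(* Found by a branch and bound search. *)
Definition certificate : tree :=
(SplitY
 (SplitW 17677 17677
  (SplitW 23096 9567
   (SplitX
    (SplitY
     (Leaf (74,75,1) [::(4,5,1000);(6,7,1000)] (0,0,1) [::(1,40,-1000);(42,43,-140);
       (44,45,-1000);(46,47,-1000);(48,49,-1000);(50,51,-1000);(52,53,-608);(54,55,0);(56,57,0);
         (58,59,0);(60,61,0);(62,63,0);(64,65,0);(66,67,1000);(68,69,1000);(70,71,1000);
           (72,73,1000)])
     (SplitY
      (Leaf (54,55,-1) [::(56,57,0);(58,59,0);(60,61,0);(62,63,0);(64,65,0);(66,67,0);
        (68,69,1000);(70,71,1000)] (72,73,1) [::(74,75,1000);(4,5,1000);(6,8,1000);(0,0,0);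
          (1,40,-872);(48,49,-1000);(50,51,-1000);(52,53,-995)])
      (SplitY
       (Leaf (74,75,1) [::(4,5,1000);(6,9,1000)] (0,0,1) [::(1,42,-915);(54,55,0);(56,57,0);
         (58,59,0);(60,61,0);(62,63,0);(64,65,0);(66,67,779);(68,69,1000);(70,71,1000);
           (72,73,1000)])
       (SplitY
        (Leaf (74,75,1) [::(4,5,1000);(6,7,1000);(8,11,1000)] (0,0,1) [::(1,2,-849);(56,57,0);
          (58,59,0);(60,61,0);(62,63,0);(64,65,0);(66,67,63);(68,69,1000);(70,71,1000);
            (72,73,1000)])
        (SplitX
         (SplitY
          (Leaf (0,0,1) [::(1,37,-804);(38,39,-1000);(40,41,-1000)] (42,2,-1) [::(58,59,0);
            (60,64,0);(68,69,476);(70,71,1000);(72,73,1000);(74,75,1000);(4,5,1000);(6,7,1000);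
              (8,11,1000)])
          (SplitX
           (Leaf (0,0,1) [::(1,35,-1000);(36,37,-1000)] (38,39,-1) [::(40,41,-1000);
             (42,43,-1000);(44,45,-1000);(2,58,0);(3,68,1000);(70,71,1000);(72,73,1000);
              (74,75,1000);(4,5,1000);(6,7,1000);(8,9,1000);(10,11,1000)])
           (Leaf (0,0,1) [::(1,37,-278)] (38,39,-1) [::(40,41,-1000);(42,43,-1000);(2,3,0);
             (68,69,1000);(70,71,1000);(72,73,1000);(74,75,1000);(4,5,1000);(6,7,1000);
              (8,9,1000);(10,11,1000);(12,13,167)])))
         (Leaf (0,0,1) [::] (1,1,-1) [::(2,58,-242);(64,65,0);(66,67,1000);(68,69,1000);
           (70,71,1000);(72,73,1000);(74,75,1000);(4,5,1000);(6,7,1000);(8,9,1000);(10,11,1000);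
             (12,15,618)]))))))
    (Leaf (0,0,1) [::] (1,1,-1) [::(2,49,-193);(60,61,0);(62,63,0);(64,65,0);(66,67,993);
      (68,69,1000);(70,71,1000);(72,73,1000);(74,75,1000);(4,5,1000);(6,10,424)]))
   (SplitX
    (SplitY
     (Leaf (48,49,-1) [::(50,51,-1000);(52,53,-1000);(54,55,-1000);(56,57,-345);(58,59,0);
       (60,61,0);(62,63,0);(64,65,0)] (66,67,1) [::(68,69,0);(70,71,0);(72,73,1000);(74,75,1000);
         (4,5,1000);(6,7,1000);(0,0,0);(1,40,-899);(42,43,0);(44,45,-1000);(46,47,-1000)])
     (SplitY
      (Leaf (66,67,1) [::(68,69,0);(70,71,1000);(72,73,1000);(74,75,1000);(4,5,1000);
        (6,8,1000)] (0,0,1) [::(1,40,-852);(48,49,-1000);(50,51,-1000);(52,53,-1000);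
          (54,55,-1000);(56,57,-83);(58,59,0);(60,61,0);(62,63,0);(64,65,0)])
      (SplitY
       (Leaf (4,5,1) [::(6,9,1000)] (0,0,1) [::(1,42,-725);(54,55,-1000);(56,57,-1000);
         (58,59,-475);(60,61,0);(62,63,0);(64,65,0);(66,67,0);(68,69,0);(70,71,0);(72,73,1000);
           (74,75,1000)])
       (SplitY
        (SplitX
         (Leaf (0,0,1) [::(1,37,-206);(38,39,-1000);(40,41,-1000)] (42,2,-1) [::(56,57,-1000);
           (58,59,0);(60,61,0);(62,63,0);(64,65,0);(66,67,0);(68,69,0);(70,71,0);(72,73,0);
             (74,75,0);(4,5,1000);(6,7,1000);(8,10,1000)])
         (Leaf (0,0,1) [::] (1,1,-1) [::(2,55,-1000);(56,57,-1000);(58,59,0);(60,61,0);(62,63,0);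
           (64,65,0);(66,67,0);(68,69,0);(70,71,0);(72,73,1000);(74,75,1000);(4,5,1000);
             (6,7,1000);(8,9,1000);(10,13,1000)]))
        (SplitX
         (SplitY
          (SplitX
           (Leaf (0,0,1) [::(1,1,0);(36,37,-720)] (38,39,-1) [::(40,41,-1000);(42,43,-1000);
             (44,2,-1000);(56,57,0);(58,59,0);(60,64,0);(68,69,0);(70,71,0);(72,73,0);
              (74,75,285);(4,5,1000);(6,7,1000);(8,10,1000)])
           (Leaf (0,0,1) [::(1,1,-231)] (38,39,-1) [::(40,41,-1000);(42,43,-1000);(2,56,-920);
             (58,59,0);(60,62,0);(64,65,0);(66,67,0);(68,69,0);(70,71,0);(72,73,0);(74,75,1000);
              (4,5,1000);(6,7,1000);(8,9,1000);(10,12,1000)]))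
          (SplitY
           (SplitW 20786 13889
            (Leaf (0,0,1) [::(1,37,-272)] (38,39,-1) [::(40,41,-1000);(42,44,-1000);(2,57,-742);
              (58,3,0);(70,71,0);(72,73,663);(74,75,1000);(4,5,1000);(6,7,1000);(8,9,1000);
              (10,12,1000)])
            (Leaf (74,75,1) [::(4,5,1000);(6,7,1000);(8,9,1000);
              (10,12,1000)] (0,0,1) [::(1,37,0);(38,39,-1000);(40,41,-1000);(42,44,-1000);
              (2,57,-959);(58,3,0);(70,71,0);(72,73,0)]))
           (SplitW 20786 13889
            (Leaf (38,39,-1) [::(40,41,-1000);(42,44,-1000)] (2,2,-1) [::(3,67,0);(70,71,0);
              (72,73,0);(74,75,974);(4,5,1000);(6,7,1000);(8,9,1000);(10,12,1000);(0,0,0);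
              (1,36,-107)])
            (SplitW 19325 15859
             (Leaf (2,2,-1) [::(3,67,0);(70,71,0);(72,73,6)] (74,75,1) [::(4,5,1000);(6,7,1000);
              (8,9,1000);(10,12,1000);(0,0,6);(1,36,0);(38,39,-1000);(40,41,-1000);(42,44,-1000)])
             (SplitX
              (Leaf (74,75,1) [::(4,5,1000);(6,7,1000);(8,9,1000);
              (10,11,1000)] (0,0,1) [::(1,35,0);(36,37,0);(38,39,-994);(40,41,-1000);
              (42,43,-1000);(44,45,-1000);(2,2,-577);(3,68,0);(70,71,0);(72,73,0)])
              (Leaf (0,0,1) [::(1,37,0)] (38,39,-1) [::(40,41,-1000);(42,43,-1000);(2,2,-648);
              (3,66,0);(68,69,0);(70,71,0);(72,73,0);(74,75,415);(4,5,1000);(6,7,1000);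
              (8,9,1000);(10,11,1000);(12,14,1000)]))))))
         (SplitX
          (SplitX
           (SplitY
            (Leaf (74,75,1) [::(4,5,1000);(6,7,1000);(8,9,1000);(10,11,1000);
              (12,13,1000)] (0,0,1) [::(1,39,-274);(40,41,-1000);(2,56,-894);(58,59,0);(60,61,0);
              (62,63,0);(64,65,0);(66,67,0);(68,69,0);(70,71,0);(72,73,0)])
            (SplitY
             (Leaf (74,75,1) [::(4,5,1000);(6,7,1000);(8,9,1000);(10,11,1000);(12,13,1000);
              (14,15,1000)] (0,0,1) [::(1,39,-237);(40,41,-1000);(2,57,-849);(58,59,0);(60,61,0);
              (62,63,0);(64,65,0);(66,67,0);(68,69,0);(70,71,0);(72,73,0)])
             (SplitY
              (Leaf (74,75,1) [::(4,5,1000);(6,7,1000);(8,9,1000);(10,11,1000);(12,13,1000);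
              (14,15,1000)] (0,0,1) [::(1,39,-315);(40,41,-1000);(2,3,-548);(64,65,0);(66,67,0);
              (68,69,0);(70,71,0);(72,73,200)])
              (Leaf (74,75,1) [::(4,5,1000);(6,7,1000);(8,9,1000);(10,11,1000);(12,13,1000);
              (14,15,1000);(16,0,1000)] (0,0,1) [::(1,39,-270);(40,41,-1000);(2,2,-708);(3,63,0);
              (64,65,0);(66,67,0);(68,69,0);(70,71,0);(72,73,624)]))))
           (Leaf (0,0,1) [::] (1,40,-1) [::(2,58,-662);(62,63,0);(64,65,0);(66,67,0);(68,69,0);
             (70,71,0);(72,73,372);(74,75,1000);(4,5,1000);(6,7,1000);(8,9,1000);(10,11,1000);
              (12,13,1000);(14,15,1000)]))
          (Leaf (0,0,1) [::] (1,1,-1) [::(2,58,-677);(62,63,0);(64,65,0);(66,67,0);(68,69,0);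
            (70,71,19);(72,73,1000);(74,75,1000);(4,5,1000);(6,7,1000);(8,9,1000);(10,11,1000);
              (12,13,1000);(14,16,1000)])))))))
    (Leaf (0,0,1) [::] (1,1,-1) [::(2,49,-821);(60,61,0);(62,63,0);(64,65,0);(66,67,0);(68,69,0);
      (70,71,464);(72,73,1000);(74,75,1000);(4,5,1000);(6,10,1000)])))
  (SplitW 9567 23096
   (SplitX
    (SplitY
     (Leaf (74,75,1) [::(4,5,0);(6,7,0)] (0,0,1) [::(1,40,0);(42,43,0);(44,45,0);(46,47,0);
       (48,49,0);(50,51,0);(52,53,0);(54,55,0);(56,57,0);(58,59,0);(60,61,0);(62,63,0);(64,65,0);
         (66,67,0);(68,69,0);(70,71,0);(72,73,0)])
     (SplitY
      (Leaf (74,75,1) [::(4,5,0);(6,8,124)] (0,0,1) [::(1,40,0);(48,49,-1000);(50,51,-1000);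
        (52,53,-1000);(54,55,-202);(56,57,0);(58,59,0);(60,61,0);(62,63,0);(64,65,0);(66,67,0);
          (68,69,0);(70,71,0);(72,73,0)])
      (SplitY
       (SplitX
        (Leaf (0,0,1) [::(1,38,0);(40,41,-342);(42,43,-1000)] (44,48,-1) [::(52,53,-1000);
          (54,55,-1000);(56,57,-1000);(58,59,-1000);(60,61,0);(62,63,0);(64,65,0);(66,67,0);
            (68,69,0);(70,71,0);(72,73,0);(74,75,0);(4,5,0);(6,8,524)])
        (Leaf (58,59,-1) [::(60,61,-1000);(62,63,-1000);(64,65,0);(66,67,0);(68,69,0);(70,71,0);
          (72,73,0);(74,75,0)] (4,5,1) [::(6,7,494);(8,9,1000);(10,11,1000);(0,0,251);(1,2,-594);
            (54,55,-1000);(56,57,-1000)]))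
       (SplitX
        (SplitY
         (Leaf (0,0,1) [::(1,37,0)] (38,39,-1) [::(40,41,-734);(42,2,-1000);(56,57,-1000);
           (58,59,-1000);(60,61,-1000);(62,63,0);(64,65,0);(66,67,0);(68,69,0);(70,71,0);
             (72,73,0);(74,75,0);(4,5,0);(6,7,782);(8,10,859)])
         (SplitY
          (SplitW 13889 20786
           (Leaf (0,0,1) [::(1,37,0)] (38,39,-1) [::(40,41,-863);(42,2,-1000);(58,59,-1000);
             (60,64,0);(68,69,0);(70,71,0);(72,73,0);(74,75,0);(4,5,34);(6,7,1000);(8,11,1000)])
           (SplitX
            (SplitX
             (Leaf (60,3,-1) [::(68,69,0);(70,71,0);(72,73,0);(74,75,0);(4,5,0);(6,7,0);
              (8,10,904)] (0,0,1) [::(1,35,0);(36,37,0);(38,39,0);(40,41,0);(42,43,-1000);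
              (44,45,-1000);(46,2,-1000);(56,57,-1000);(58,59,-1000)])
             (Leaf (60,63,-1) [::(66,67,0);(68,69,0);(70,71,0);(72,73,0);(74,75,0);(4,5,0);
              (6,7,184);(8,9,1000);(10,11,1000)] (0,0,1) [::(1,1,0);(36,37,0);(38,39,0);
              (40,41,-1000);(42,43,-1000);(44,46,-1000);(2,2,-1000);(56,57,-1000);(58,59,-1000)]))
            (Leaf (0,0,1) [::(1,1,0)] (38,39,-1) [::(40,41,-608);(42,43,-1000);(2,56,-1000);
              (58,59,-1000);(60,62,-1000);(64,65,0);(66,67,0);(68,69,0);(70,71,0);(72,73,0);
              (74,75,0);(4,5,0);(6,7,67);(8,9,1000);(10,12,1000)])))
          (SplitY
           (SplitX
            (Leaf (0,0,1) [::(1,35,0);(36,37,0)] (38,39,-1) [::(40,41,-588);(42,43,-1000);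
              (44,46,-1000);(2,57,-1000);(58,59,-972);(3,68,0);(70,71,0);(72,73,0);(74,75,0);
              (4,5,18);(6,7,1000);(8,9,1000);(10,11,1000)])
            (SplitW 13889 20786
             (Leaf (58,3,-1) [::(66,67,0);(68,69,0);(70,71,0);(72,73,0);(74,75,0);(4,5,228);
              (6,7,1000);(8,9,1000);(10,11,1000);(12,13,1000)] (0,0,1) [::(1,37,0);(38,39,0);
              (40,41,-1000);(42,43,-1000);(2,57,-1000)])
             (Leaf (58,3,-1) [::(66,67,0);(68,69,0);(70,71,0);(72,73,0);(74,75,0);(4,5,0);
              (6,7,177);(8,9,1000);(10,11,1000);(12,13,1000)] (0,0,1) [::(1,37,0);(38,39,0);
              (40,41,-1000);(42,43,-1000);(2,57,-1000)])))
           (SplitX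
            (Leaf (0,0,1) [::(1,35,0);(36,37,0)] (38,39,-1) [::(40,41,-189);(42,43,-1000);
              (44,45,-1000);(2,2,-994);(3,68,0);(70,71,0);(72,73,0);(74,75,0);(4,5,195);
              (6,7,1000);(8,9,1000);(10,11,1000)])
            (Leaf (0,0,1) [::(1,37,0)] (38,39,-1) [::(40,41,0);(42,43,-999);(2,2,-1000);(3,66,0);
              (68,69,0);(70,71,0);(72,73,0);(74,75,0);(4,5,1);(6,7,1000);(8,9,1000);(10,11,1000);
              (12,14,1000)])))))
        (SplitX
         (SplitX
          (SplitY
           (Leaf (74,75,1) [::(4,5,0);(6,7,0);(8,9,307);(10,12,917)] (0,0,1) [::(1,39,0);
             (40,42,-941);(2,54,-1000);(56,57,-1000);(58,59,-1000);(60,61,-1000);(62,63,0);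
              (64,65,0);(66,67,0);(68,69,0);(70,71,0);(72,73,0)])
           (SplitW 13889 20786
            (SplitY
             (Leaf (74,75,1) [::(4,5,0);(6,7,1000);(8,9,1000);(10,11,1000);
              (12,13,1000)] (0,0,1) [::(1,39,-84);(40,41,-1000);(2,56,-1000);(58,59,-1000);
              (60,61,-686);(62,63,0);(64,65,0);(66,67,0);(68,69,0);(70,71,0);(72,73,0)])
             (SplitX
              (SplitY
               (Leaf (0,0,1) [::(1,39,0)] (38,39,-1) [::(40,41,-1000);(42,2,-1000);(2,57,-1000);
              (58,59,-1000);(60,61,-121);(62,63,0);(64,65,0);(66,67,0);(68,69,0);(70,71,0);
              (72,73,0);(74,75,0);(4,5,430);(6,7,1000);(8,9,1000);(10,11,1000);(12,13,1000);
              (14,0,1000)])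
               (SplitY
                (Leaf (0,0,1) [::(1,39,-44)] (38,39,-1) [::(40,41,-1000);(42,2,-1000);
              (2,3,-1000);(64,65,0);(66,67,0);(68,69,0);(70,71,0);(72,73,0);(74,75,0);(4,5,1000);
              (6,7,1000);(8,9,1000);(10,11,1000);(12,13,1000);(14,15,1000)])
                (Leaf (0,0,1) [::(1,39,0)] (38,39,-1) [::(40,41,-869);(42,41,-1000);(2,2,-1000);
              (3,63,0);(64,65,0);(66,67,0);(68,69,0);(70,71,0);(72,73,0);(74,75,0);(4,5,875);
              (6,7,1000);(8,9,1000);(10,11,1000);(12,13,1000);(14,15,1000);(16,0,1000)])))
              (Leaf (72,73,1) [::(74,75,614);(4,5,1000);(6,7,1000);(8,9,1000);(10,11,1000);
              (12,13,1000);(14,15,1000)] (0,0,1) [::(1,39,-328);(40,41,-1000);(2,59,-1000);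
              (64,65,0);(66,67,0);(68,69,0);(70,71,0)])))
            (Leaf (74,75,1) [::(4,5,0);(6,7,0);(8,9,780);(10,11,1000);
              (12,14,926)] (0,0,1) [::(1,39,0);(40,41,-932);(2,59,-1000);(64,65,0);(66,67,0);
              (68,69,0);(70,71,0);(72,73,0)])))
          (Leaf (0,0,1) [::] (1,40,-1) [::(2,57,-1000);(62,63,0);(64,65,0);(66,67,0);(68,69,0);
            (70,71,0);(72,73,0);(74,75,0);(4,5,0);(6,7,990);(8,9,1000);(10,11,1000);
              (12,14,1000)]))
         (Leaf (0,0,1) [::] (1,1,-1) [::(2,57,-1000);(62,63,0);(64,65,0);(66,67,0);(68,69,0);
           (70,71,0);(72,73,0);(74,75,0);(4,5,292);(6,7,1000);(8,9,1000);(10,11,1000);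
             (12,15,1000)]))))))
    (Leaf (0,0,1) [::] (1,1,-1) [::(2,49,-1000);(60,61,0);(62,63,0);(64,65,0);(66,67,0);
      (68,69,0);(70,71,0);(72,73,0);(74,75,0);(4,5,247);(6,10,1000)]))
   (SplitX
    (SplitY
     (Leaf (74,75,1) [::(4,5,0);(6,7,0)] (0,0,1) [::(1,40,0);(42,43,0);(44,45,0);(46,47,0);
       (48,49,0);(50,51,0);(52,53,0);(54,55,0);(56,57,0);(58,59,0);(60,61,0);(62,63,0);(64,65,0);
         (66,67,0);(68,69,0);(70,71,0);(72,73,0)])
     (SplitY
      (Leaf (72,73,-1) [::(74,75,0);(4,5,1000);(6,8,0)] (0,0,1) [::(1,40,0);(48,49,0);
        (50,51,-782);(52,53,-1000);(54,55,-1000);(56,57,-1000);(58,59,-1000);(60,61,-517);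
          (62,63,0);(64,65,0);(66,67,0);(68,69,0);(70,71,0)])
      (SplitY
       (SplitX
        (Leaf (0,0,1) [::(1,38,0);(40,41,0);(42,43,0)] (44,48,-1) [::(52,53,-1000);(54,55,-1000);
          (56,57,-1000);(58,59,-1000);(60,61,-1000);(62,63,-631);(64,65,0);(66,67,0);(68,69,0);
            (70,71,0);(72,73,0);(74,75,0);(4,5,0);(6,8,175)])
        (SplitX
         (Leaf (62,63,-1) [::(64,65,0);(66,67,0);(68,69,0);(70,71,0);(72,73,0);(74,75,0);(4,5,0);
           (6,7,0);(8,9,0);(10,0,221)] (0,0,1) [::(1,42,-89);(52,53,-1000);(54,55,-1000);
             (56,57,-1000);(58,59,-1000);(60,61,-1000)])
         (Leaf (0,0,1) [::] (1,1,-1) [::(2,51,-1000);(54,55,-1000);(56,57,-1000);(58,59,-1000);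
           (60,61,-1000);(62,63,-400);(64,65,0);(66,67,0);(68,69,0);(70,71,0);(72,73,0);
             (74,75,0);(4,5,0);(6,7,0);(8,9,0);(10,12,517)])))
       (SplitX
        (SplitY
         (SplitX
          (Leaf (0,0,1) [::(1,37,0)] (38,39,-1) [::(40,41,0);(42,43,0);(44,45,0);(46,50,-692);
            (54,55,-1000);(56,57,-1000);(58,59,-1000);(60,61,-1000);(62,63,-913);(64,65,0);
              (66,67,0);(68,69,0);(70,71,0);(72,73,0);(74,75,0);(4,5,0);(6,7,0);(8,9,267)])
          (SplitX
           (Leaf (0,0,1) [::(1,1,0);(38,39,0);(40,41,0);(42,43,0)] (44,2,-1) [::(56,57,-1000);
             (58,59,-1000);(60,61,-1000);(62,63,-1000);(64,65,-268);(66,67,0);(68,69,0);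
              (70,71,0);(72,73,0);(74,75,0);(4,5,0);(6,7,0);(8,9,0);(10,0,317)])
           (Leaf (0,0,1) [::(1,1,0)] (38,39,-1) [::(40,41,0);(42,43,-495);(2,54,-1000);
             (56,57,-1000);(58,59,-1000);(60,61,-1000);(62,63,-918);(64,65,0);(66,67,0);
              (68,69,0);(70,71,0);(72,73,0);(74,75,0);(4,5,0);(6,7,0);(8,9,0);(10,11,505)])))
         (SplitY
          (SplitX
           (SplitX
            (SplitW 4877 24519
             (SplitY
              (Leaf (0,0,1) [::(1,35,0);(36,37,0);(38,39,0);(40,41,0);(42,43,0);
              (44,45,0)] (46,2,-1) [::(56,57,-1000);(58,59,-1000);(60,61,-1000);(62,65,-132);
              (68,69,0);(70,71,0);(72,73,0);(74,75,0);(4,5,0);(6,7,0);(8,9,451)])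
              (SplitY
               (SplitX
                (Leaf (0,0,1) [::(1,35,0);(36,37,0)] (38,39,-1) [::(40,41,0);(42,43,0);(44,45,0);
              (46,47,-1000);(48,2,-760);(2,55,-1000);(56,57,-1000);(58,59,-1000);(60,61,-745);
              (3,67,0);(68,69,0);(70,71,0);(72,73,0);(74,75,0);(4,5,0);(6,7,0);(8,9,0);
              (10,9,553)])
                (Leaf (60,3,-1) [::(66,67,0);(68,69,0);(70,71,0);(72,73,0);(74,75,0);(4,5,0);
              (6,7,0);(8,9,0);(10,0,604)] (0,0,1) [::(1,1,0);(36,37,0);(38,39,0);(40,41,0);
              (42,43,0);(44,45,-171);(46,47,-1000);(2,2,-1000);(56,57,-1000);(58,59,-1000)]))
               (Leaf (0,0,1) [::(1,35,0);(36,37,0)] (38,39,-1) [::(40,41,0);(42,43,0);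
              (44,45,-602);(46,47,-595);(2,2,-1000);(56,57,-1000);(58,59,-1000);(60,3,-850);
              (3,67,0);(68,69,0);(70,71,0);(72,73,0);(74,75,0);(4,5,0);(6,7,0);(8,9,0);
              (10,0,570)])))
             (SplitY
              (SplitX
               (SplitY
                (Leaf (0,0,1) [::(1,35,0);(36,37,0);(38,39,0);(40,41,0);(42,43,0);(44,45,0);
              (46,47,0)] (48,2,-1) [::(54,55,-1000);(56,57,-1000);(58,59,-1000);(60,61,-1000);
              (62,64,-526);(66,67,0);(68,69,0);(70,71,0);(72,73,0);(74,75,0);(4,5,0);(6,7,0);
              (8,9,129)])
                (Leaf (74,75,1) [::(4,5,0);(6,7,0);(8,9,132)] (0,0,1) [::(1,35,0);(36,37,0);
              (38,39,0);(40,41,0);(42,43,0);(44,45,0);(46,47,0);(48,2,-553);(2,55,-1000);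
              (56,57,-1000);(58,59,-1000);(60,61,-1000);(62,3,-273);(68,69,0);(70,71,0);
              (72,73,0)]))
               (Leaf (74,75,1) [::(4,5,0);(6,7,0);(8,9,0);(10,0,162)] (0,0,1) [::(1,1,0);
              (36,37,0);(38,39,0);(40,41,0);(42,43,0);(44,45,0);(46,47,-297);(2,55,-1000);
              (56,57,-1000);(58,59,-1000);(60,61,-1000);(62,64,-367);(66,67,0);(68,69,0);
              (70,71,0);(72,73,0)]))
              (SplitY
               (SplitX
                (Leaf (0,0,1) [::(1,35,0);(36,37,0)] (38,39,-1) [::(40,41,0);(42,43,0);(44,45,0);
              (46,47,-367);(48,2,-204);(2,55,-1000);(56,57,-1000);(58,59,-1000);(60,61,-924);
              (3,67,0);(68,69,0);(70,71,0);(72,73,0);(74,75,0);(4,5,0);(6,7,0);(8,9,0);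
              (10,9,171)])
                (SplitY
                 (Leaf (0,0,1) [::(1,1,0);(36,37,0)] (38,39,-1) [::(40,41,0);(42,43,0);(44,45,0);
              (46,47,-306);(2,55,-1000);(56,57,-1000);(58,59,-1000);(60,61,-1000);(62,3,-374);
              (66,67,0);(68,69,0);(70,71,0);(72,73,0);(74,75,0);(4,5,0);(6,7,0);(8,9,0);
              (10,0,166)])
                 (Leaf (0,0,1) [::(1,1,0);(36,37,0)] (38,39,-1) [::(40,41,0);(42,43,0);(44,45,0);
              (46,47,-269);(2,2,-1000);(56,57,-1000);(58,59,-1000);(60,61,-953);(3,3,0);
              (66,67,0);(68,69,0);(70,71,0);(72,73,0);(74,75,0);(4,5,0);(6,7,0);(8,9,0);
              (10,0,172)])))
               (Leaf (0,0,1) [::(1,35,0);(36,37,0)] (38,39,-1) [::(40,41,0);(42,43,0);(44,45,0);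
              (46,47,-244);(2,2,-1000);(56,57,-1000);(58,59,-1000);(60,3,-934);(3,67,0);
              (68,69,0);(70,71,0);(72,73,0);(74,75,0);(4,5,0);(6,7,0);(8,9,0);(10,0,172)]))))
            (SplitW 4877 24519
             (Leaf (60,63,-1) [::(66,67,0);(68,69,0);(70,71,0);(72,73,0);(74,75,0);(4,5,0);
              (6,7,0);(8,9,0);(10,11,805)] (0,0,1) [::(1,1,0);(36,37,0);(38,39,0);(40,41,0);
              (42,43,0);(44,46,-1000);(2,2,-1000);(56,57,-1000);(58,59,-1000)])
             (SplitY
              (Leaf (0,0,1) [::(1,1,0);(36,37,0)] (38,39,-1) [::(40,41,0);(42,43,0);(44,46,-95);
              (2,55,-1000);(56,57,-1000);(58,59,-1000);(60,61,-1000);(62,63,-596);(64,65,0);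
              (66,67,0);(68,69,0);(70,71,0);(72,73,0);(74,75,0);(4,5,0);(6,7,0);(8,9,0);
              (10,0,157)])
              (SplitY
               (Leaf (62,64,-1) [::(66,67,0);(68,69,0);(70,71,0);(72,73,0);(74,75,0);(4,5,0);
              (6,7,0)] (8,9,1) [::(10,11,174);(0,0,1000);(1,1,0);(36,37,0);(38,39,0);(40,41,0);
              (42,43,0);(44,45,-253);(2,2,-1000);(56,57,-1000);(58,59,-1000);(60,61,-1000)])
               (SplitX
                (Leaf (0,0,1) [::(1,1,0);(36,37,0)] (38,39,-1) [::(40,41,0);(42,43,0);(44,45,0);
              (46,2,-267);(2,2,-1000);(56,57,-1000);(58,59,-1000);(60,61,-1000);(3,65,-23);
              (66,67,0);(68,69,0);(70,71,0);(72,73,0);(74,75,0);(4,5,0);(6,7,0);(8,9,0);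
              (10,11,176)])
                (Leaf (0,0,1) [::(1,1,0);(36,37,0);(38,39,0)] (40,41,-1) [::(42,43,0);
              (44,45,-256);(2,2,-1000);(56,57,-1000);(58,59,-1000);(60,3,-498);(66,67,0);
              (68,69,0);(70,71,0);(72,73,0);(74,75,0);(4,5,0);(6,7,0);(8,9,0);(10,11,179)]))))))
           (Leaf (40,41,-1) [::(42,43,-360);(2,56,-1000);(58,59,-1000)] (60,62,-1) [::(64,65,0);
             (66,67,0);(68,69,0);(70,71,0);(72,73,0);(74,75,0);(4,5,0);(6,7,0);(8,9,0);
              (10,12,405);(0,0,1000);(1,1,0);(38,39,0)]))
          (SplitX
           (SplitW 4877 24519
            (SplitW 7257 23923
             (Leaf (0,0,1) [::(1,35,0);(36,37,0);(38,39,0)] (40,41,-1) [::(42,43,-57);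
              (44,45,-735);(2,58,-1000);(3,68,0);(70,71,0);(72,73,0);(74,75,0);(4,5,0);(6,7,0);
              (8,9,0);(10,11,974)])
             (SplitY
              (Leaf (0,0,1) [::(1,35,0);(36,37,0);(38,39,0);
              (40,41,0)] (42,43,-1) [::(44,46,-413);(2,57,-1000);(58,59,-959);(3,68,0);(70,71,0);
              (72,73,0);(74,75,0);(4,5,0);(6,7,0);(8,9,0);(10,11,509)])
              (Leaf (0,0,1) [::(1,35,0);(36,37,0);(38,39,0)] (40,41,-1) [::(42,43,0);
              (44,45,-415);(2,2,-1000);(3,68,-4);(70,71,0);(72,73,0);(74,75,0);(4,5,0);(6,7,0);
              (8,9,0);(10,11,536)])))
            (Leaf (0,0,1) [::(1,35,0);(36,37,0);(38,39,0)] (40,41,-1) [::(42,43,0);(44,45,-42);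
              (2,58,-1000);(3,68,0);(70,71,0);(72,73,0);(74,75,0);(4,5,0);(6,7,0);(8,9,0);
              (10,11,55)]))
           (SplitY
            (SplitW 4877 24519
             (Leaf (58,3,-1) [::(66,67,0);(68,69,0);(70,71,0);(72,73,0);(74,75,0);(4,5,0);
              (6,7,0);(8,9,0);(10,11,759);(12,13,759)] (0,0,1) [::(1,37,0);(38,39,0);(40,41,0);
              (42,43,-760);(2,57,-1000)])
             (SplitX
              (SplitY
               (Leaf (60,63,-1) [::(66,67,0);(68,69,0);(70,71,0);(72,73,0);(74,75,0);(4,5,0);
              (6,7,0)] (8,9,1) [::(10,11,0);(12,0,252);(0,0,1000);(1,37,0);(38,39,0);(40,41,0);
              (42,44,-251);(2,57,-1000);(58,59,-1000)])
               (Leaf (0,0,1) [::(1,37,0)] (38,39,-1) [::(40,41,0);(42,43,-186);(2,57,-1000);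
              (58,59,-1000);(3,65,-173);(66,67,0);(68,69,0);(70,71,0);(72,73,0);(74,75,0);
              (4,5,0);(6,7,0);(8,9,0);(10,11,0);(12,13,259)]))
              (Leaf (4,5,1) [::(6,7,0);(8,9,0);(10,11,0);(12,13,600)] (0,0,1) [::(1,1,31);
              (38,39,0);(40,41,0);(42,2,-430);(2,57,-1000);(58,61,-1000);(64,65,0);(66,67,0);
              (68,69,0);(70,71,0);(72,73,0);(74,75,0)])))
            (SplitW 4877 24519
             (Leaf (0,0,1) [::(1,37,0)] (38,39,-1) [::(40,41,0);(42,43,-709);(2,2,-1000);
              (3,66,-506);(68,69,0);(70,71,0);(72,73,0);(74,75,0);(4,5,0);(6,7,0);(8,9,0);
              (10,11,183);(12,14,1000)])
             (Leaf (0,0,1) [::(1,37,0)] (38,39,-1) [::(40,41,0);(42,43,0);(2,2,-1000);(3,66,0);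
              (68,69,0);(70,71,0);(72,73,0);(74,75,0);(4,5,0);(6,7,0);(8,9,0);(10,11,0);
              (12,14,0)]))))))
        (SplitX
         (SplitX
          (Leaf (74,75,1) [::(4,5,0);(6,7,0);(8,9,0);(10,13,536)] (0,0,1) [::(1,39,0);
            (40,41,-437);(2,58,-1000);(64,65,-32);(66,67,0);(68,69,0);(70,71,0);(72,73,0)])
          (Leaf (0,0,1) [::] (1,40,-1) [::(2,57,-1000);(62,63,-1000);(64,65,0);(66,67,0);
            (68,69,0);(70,71,0);(72,73,0);(74,75,0);(4,5,0);(6,7,0);(8,9,0);(10,11,0);
              (12,14,618)]))
         (Leaf (0,0,1) [::] (1,1,-1) [::(2,57,-1000);(62,63,-1000);(64,65,0);(66,67,0);(68,69,0);
           (70,71,0);(72,73,0);(74,75,0);(4,5,0);(6,7,0);(8,9,0);(10,11,0);(12,15,689)]))))))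
    (Leaf (1,1,-1) [::(2,49,-1000)] (60,61,-1) [::(62,63,-1000);(64,65,-1000);(66,67,0);
      (68,69,0);(70,71,0);(72,73,0);(74,75,0);(4,5,0);(6,10,737);(0,0,944)]))))
 (SplitW 17677 17677
  (SplitW 23096 9567
   (SplitX
    (SplitY
     (SplitY
      (SplitY
       (SplitY
        (SplitX
         (SplitY
          (SplitX
           (Leaf (0,22,1) [::(1,35,-1000);(36,37,-1000)] (38,39,-1) [::(40,41,-1000);
             (42,43,-1000);(44,45,-1000);(2,2,0);(3,69,1000);(70,71,1000);(72,73,1000);
              (74,75,1000);(4,5,1000);(6,7,1000);(8,9,1000);(10,12,1000)])
           (Leaf (38,39,-1) [::(40,41,-1000);(42,43,-1000)] (2,2,-1) [::(3,67,0);(68,69,910);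
             (70,71,1000);(72,73,1000);(74,75,1000);(4,5,1000);(6,7,1000);(8,9,1000);
              (10,11,1000);(12,0,166);(1,37,-158)]))
          (Leaf (12,16,1) [::(20,21,0)] (22,1,-1) [::(38,39,-1000);(40,41,-1000);(42,43,-1000);
            (2,2,0);(3,69,379);(72,73,1000);(74,75,1000);(4,5,1000);(6,7,1000);(8,9,1000);
              (10,11,1000)]))
         (Leaf (1,1,-1) [::] (2,2,-1) [::(3,65,311);(68,69,1000);(70,71,1000);(72,73,1000);
           (74,75,1000);(4,5,1000);(6,7,1000);(8,9,1000);(10,11,1000);(12,13,1000);(14,15,1000);
             (16,22,0)]))
        (SplitX
         (Leaf (24,1,-1) [::(38,39,-1000);(40,41,-1000);(42,43,-1000)] (2,2,-1) [::(3,70,374);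
           (72,73,1000);(74,75,1000);(4,5,1000);(6,7,1000);(8,9,1000);(10,11,1000);(12,13,1000);
             (14,15,1000);(16,17,613);(18,19,0);(20,21,0);(22,23,0)])
         (Leaf (1,1,-1) [::] (2,2,-1) [::(3,67,635);(70,71,1000);(72,73,1000);(74,75,1000);
           (4,5,1000);(6,7,1000);(8,9,1000);(10,11,1000);(12,13,1000);(14,15,1000);(16,17,1000);
             (18,19,489);(20,21,0);(22,23,0);(24,25,0)])))
       (Leaf (2,2,-1) [::(3,71,1000)] (74,75,1) [::(4,5,1000);(6,7,1000);(8,9,1000);(10,11,1000);
         (12,13,761);(14,15,0);(16,17,0);(18,19,0);(20,21,0);(22,23,0);(24,25,0);(26,38,-914)]))
      (Leaf (2,2,-1) [::(3,72,952);(74,75,0)] (4,5,1) [::(6,7,1000);(8,9,1000);(10,11,1000);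
        (12,13,1000);(14,15,1000);(16,17,934);(18,19,0);(20,21,0);(22,23,0);(24,25,0);(26,27,0);
          (28,29,0);(30,31,0);(32,40,-1000)]))
     (Leaf (74,75,1) [::(4,5,1000);(6,7,1000);(8,9,1000);(10,11,1000);(12,13,1000);(14,15,1000);
       (16,17,633);(18,19,0)] (20,21,1) [::(22,23,0);(24,25,0);(26,27,0);(28,29,0);(30,31,0);
         (32,33,-1000);(34,35,-1000);(36,37,-1000);(38,40,-1000);(2,2,0);(3,73,934)]))
    (Leaf (1,1,-1) [::] (2,2,-1) [::(3,70,249);(74,75,1000);(4,5,1000);(6,7,1000);(8,9,1000);
      (10,11,1000);(12,13,1000);(14,15,1000);(16,17,0);(18,19,0);(20,31,0)]))
   (SplitY
    (SplitX
     (SplitY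
      (SplitY
       (SplitX
        (SplitY
         (SplitY
          (SplitY
           (SplitW 20786 13889
            (Leaf (38,39,-1) [::(40,41,-1000);(42,44,-1000)] (2,2,-1) [::(3,68,0);(70,71,0);
              (72,73,685);(74,75,1000);(4,5,1000);(6,7,1000);(8,9,1000);(10,13,1000);(0,0,0);
              (1,36,-136)])
            (SplitW 19325 15859
             (Leaf (38,39,-1) [::(40,41,-1000);(42,44,-1000)] (2,2,-1) [::(3,68,0);(70,71,0);
              (72,73,0);(74,75,994);(4,5,1000);(6,7,1000);(8,9,1000);(10,13,1000);(0,0,14);
              (1,36,0)])
             (SplitX
              (Leaf (38,39,-1) [::(40,41,-1000);(42,43,-1000);
              (44,45,-1000)] (2,2,-1) [::(3,69,0);(70,71,0);(72,73,0);(74,75,994);(4,5,1000);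
              (6,7,1000);(8,9,1000);(10,12,1000);(0,0,545);(1,35,0);(36,37,0)])
              (Leaf (0,0,1) [::(1,37,0)] (38,39,-1) [::(40,41,-1000);(42,43,-1000);(2,2,-690);
              (3,66,0);(68,69,0);(70,71,0);(72,73,0);(74,75,994);(4,5,1000);(6,7,1000);
              (8,9,1000);(10,11,1000);(12,14,1000)]))))
           (SplitW 20786 13889
            (Leaf (2,2,-1) [::(3,68,0);(70,71,332);(72,73,1000);(74,75,1000);(4,5,1000);
              (6,7,1000);(8,9,1000)] (10,0,1) [::(22,23,0);(1,36,0);(38,39,-1000);(40,41,-1000);
              (42,43,-1000)])
            (Leaf (38,39,-1) [::(40,41,-1000);(42,43,-1000)] (2,2,-1) [::(3,68,0);(70,71,0);
              (72,73,118);(74,75,1000);(4,5,1000);(6,7,1000);(8,9,1000);(10,0,1000);(22,23,0);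
              (1,36,0)])))
          (Leaf (38,39,-1) [::(40,41,-1000);(42,43,-1000)] (2,2,-1) [::(3,69,0);(72,73,411);
            (74,75,1000);(4,5,1000);(6,7,1000);(8,9,1000);(10,11,1000);(12,16,1000);(20,21,169);
              (22,1,0)]))
         (Leaf (2,2,-1) [::(3,70,99)] (72,73,1) [::(74,75,1000);(4,5,1000);(6,7,1000);(8,9,1000);
           (10,11,1000);(12,13,1000);(14,15,1000);(16,17,1000);(18,19,1000);(20,21,374);
             (22,23,0);(24,1,0);(38,39,-544);(40,41,-1000);(42,43,-932)]))
        (SplitX
         (SplitY
          (SplitX
           (SplitY
            (SplitW 20786 13889
             (Leaf (2,2,-1) [::(3,65,0);(66,67,0);(68,69,0);(70,71,1000);
              (72,73,1000)] (74,75,1) [::(4,5,1000);(6,7,1000);(8,9,1000);(10,11,1000);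
              (12,13,1000);(14,15,1000);(16,21,0);(1,39,-255);(40,41,-1000)])
             (SplitY
              (SplitY
               (Leaf (74,75,1) [::(4,5,1000);(6,7,1000);(8,9,1000);(10,11,1000);(12,13,1000);
              (14,15,1000);(16,17,1000)] (0,0,1) [::(1,39,-122);(40,41,-1000);(2,2,-773);(3,3,0);
              (64,65,0);(66,67,0);(68,69,0);(70,71,0);(72,73,0)])
               (SplitY
                (Leaf (74,75,1) [::(4,5,1000);(6,7,1000);(8,9,1000);(10,11,1000);(12,13,1000);
              (14,15,1000);(16,17,1000)] (0,22,1) [::(1,39,-98);(40,41,-1000);(2,2,-755);
              (3,65,0);(66,67,0);(68,69,0);(70,71,0);(72,73,0)])
                (Leaf (2,2,-1) [::(3,65,0);(66,67,0);(68,69,0);(70,71,0);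
              (72,73,174)] (74,75,1) [::(4,5,1000);(6,7,1000);(8,9,1000);(10,11,1000);
              (12,13,1000);(14,15,1000);(16,17,1000);(18,0,1000);(22,1,0);(1,39,-126);
              (40,41,-1000)])))
              (Leaf (2,2,-1) [::(3,65,0);(66,67,0);(68,69,0);(70,71,0);
              (72,73,0)] (74,75,1) [::(4,5,1000);(6,7,1000);(8,9,1000);(10,11,1000);(12,13,1000);
              (14,15,1000);(16,17,1000);(18,19,1000);(20,21,591);(22,23,0);(1,39,-41);
              (40,41,-1000)])))
            (Leaf (2,2,-1) [::(3,67,0);(68,69,0);(70,71,0);(72,73,694)] (74,75,1) [::(4,5,1000);
              (6,7,1000);(8,9,1000);(10,11,1000);(12,13,1000);(14,15,1000);(16,17,1000);
              (18,19,1000);(20,21,0);(22,24,0);(1,39,-54);(40,41,-1000)]))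
           (SplitW 20786 13889
            (Leaf (1,40,-1) [::] (2,2,-1) [::(3,65,0);(66,67,0);(68,69,0);(70,71,1000);
              (72,73,1000);(74,75,1000);(4,5,1000);(6,7,1000);(8,9,1000);(10,11,1000);
              (12,13,1000);(14,15,1000);(16,17,1000);(18,22,0)])
            (Leaf (1,40,-1) [::] (2,2,-1) [::(3,65,0);(66,67,0);(68,69,0);(70,71,0);(72,73,847);
              (74,75,1000);(4,5,1000);(6,7,1000);(8,9,1000);(10,11,1000);(12,13,1000);
              (14,15,1000);(16,17,1000);(18,22,354)])))
          (Leaf (1,40,-1) [::] (2,2,-1) [::(3,68,0);(70,71,0);(72,73,1000);(74,75,1000);
            (4,5,1000);(6,7,1000);(8,9,1000);(10,11,1000);(12,13,1000);(14,15,1000);(16,17,1000);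
              (18,19,1000);(20,21,737);(22,23,0);(24,26,0)]))
         (Leaf (1,1,-1) [::] (2,2,-1) [::(3,65,0);(68,69,0);(70,71,0);(72,73,1000);(74,75,1000);
           (4,5,1000);(6,7,1000);(8,9,1000);(10,11,1000);(12,13,1000);(14,15,1000);(16,17,1000);
             (18,23,200)])))
       (SplitY
        (SplitY
         (SplitX
          (Leaf (28,32,-1) [::(36,37,0);(38,39,0);(40,41,-1000);
            (42,2,-754)] (2,2,-1) [::(3,71,0);(72,73,236);(74,75,1000);(4,5,1000);(6,7,1000);
              (8,9,1000);(10,11,1000);(12,13,1000);(14,15,1000);(16,17,1000);(18,19,1000);
              (20,21,0);(22,23,0);(24,25,0);(26,27,0)])
          (Leaf (1,1,-1) [::] (2,2,-1) [::(3,68,0);(70,71,0);(72,73,1000);(74,75,1000);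
            (4,5,1000);(6,7,1000);(8,9,1000);(10,11,1000);(12,13,1000);(14,15,1000);(16,17,1000);
              (18,19,1000);(20,21,0);(22,23,0);(24,25,0);(26,28,0)]))
         (Leaf (2,2,-1) [::(3,70,0);(72,73,0)] (74,75,1) [::(4,5,1000);(6,7,1000);(8,9,1000);
           (10,11,1000);(12,13,1000);(14,15,1000);(16,17,851);(18,19,0);(20,21,0);(22,23,0);
             (24,25,0);(26,27,0);(28,38,-395)]))
        (Leaf (2,2,-1) [::(3,71,0);(74,75,146)] (4,5,1) [::(6,7,1000);(8,9,1000);(10,11,1000);
          (12,13,1000);(14,15,1000);(16,17,0);(18,19,0);(20,21,0);(22,23,0);(24,25,0);(26,27,0);
            (28,38,-330)])))
      (Leaf (2,2,-1) [::(3,72,0)] (74,75,1) [::(4,5,0);(6,7,1000);(8,9,1000);(10,11,949);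
        (12,13,0);(14,15,0);(16,17,0);(18,19,0);(20,21,0);(22,23,0);(24,25,0);(26,27,0);
          (28,29,0);(30,31,0);(32,40,-187)]))
     (Leaf (1,1,-1) [::] (2,2,-1) [::(3,68,0);(72,73,1000);(74,75,1000);(4,5,1000);(6,7,1000);
       (8,9,1000);(10,11,1000);(12,13,1000);(14,15,1000);(16,17,1000);(18,19,1000);(20,27,92)]))
    (Leaf (74,75,1) [::(4,5,1000);(6,7,1000);(8,9,1000);(10,11,1000);(12,13,242);(14,15,0);
      (16,17,0);(18,19,0)] (20,21,1) [::(22,23,0);(24,25,0);(26,27,0);(28,29,0);(30,31,0);
        (32,1,-597);(2,2,0);(3,72,518)])))
  (SplitW 9567 23096
   (SplitX
    (SplitY
     (SplitY
      (SplitY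
       (SplitX
        (SplitY
         (SplitY
          (SplitY
           (SplitW 13889 20786
            (Leaf (0,0,1) [::(1,36,0)] (38,39,-1) [::(40,41,-674);(42,44,-1000);(2,2,-995);
              (3,68,0);(70,71,0);(72,73,0);(74,75,259);(4,5,1000);(6,7,1000);(8,9,1000);
              (10,13,1000)])
            (Leaf (0,0,1) [::(1,36,0);(38,39,0)] (40,41,-1) [::(42,44,-708);(2,2,-1000);(3,68,0);
              (70,71,0);(72,73,0);(74,75,0);(4,5,0);(6,7,31);(8,9,1000);(10,13,1000)]))
           (SplitX
            (SplitX
             (Leaf (40,41,-1) [::(42,43,-546);(44,45,-1000)] (2,2,-1) [::(3,3,0);(70,71,0);
              (72,73,0);(74,75,0);(4,5,595);(6,7,1000);(8,9,1000);(10,12,1000);(0,21,1000);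
              (22,23,691);(1,1,0);(34,35,0);(36,37,0);(38,39,0)])
             (Leaf (2,2,-1) [::(3,69,0);(70,71,0);(72,73,0);(74,75,0)] (4,5,1) [::(6,7,1000);
              (8,9,1000);(10,11,1000);(12,14,1000);(0,21,1000);(22,23,516);(1,35,0);(36,37,0);
              (38,39,0);(40,41,0);(42,43,-825);(44,2,-1000)]))
            (SplitW 13889 20786
             (Leaf (38,39,-1) [::(40,41,0);(42,43,-1000)] (2,2,-1) [::(3,67,0);(68,69,0);
              (70,71,0);(72,73,0);(74,75,0);(4,5,848);(6,7,1000);(8,9,1000);(10,11,1000);
              (12,13,1000);(14,0,1000);(22,23,241);(1,37,0)])
             (Leaf (14,0,1) [::(22,23,466);(1,37,0);(38,39,0)] (40,41,-1) [::(42,43,-618);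
              (2,2,-1000);(3,67,0);(68,69,0);(70,71,0);(72,73,0);(74,75,0);(4,5,0);(6,7,195);
              (8,9,1000);(10,11,1000);(12,13,1000)]))))
          (SplitX
           (SplitY
            (Leaf (2,2,-1) [::(3,3,0);(70,71,0);(72,73,0)] (74,75,1) [::(4,5,499);(6,7,1000);
              (8,9,1000);(10,11,1000);(12,0,1000);(20,21,1000);(22,23,1000);(24,1,342);(1,34,0);
              (36,37,0);(38,39,0);(40,41,0);(42,43,-545);(44,2,-1000)])
            (SplitY
             (Leaf (2,2,-1) [::(3,70,0);(72,73,0);(74,75,0);(4,5,616);(6,7,1000);(8,9,1000);
              (10,11,1000)] (12,15,1) [::(18,19,1000);(20,21,1000);(22,23,1000);(24,25,302);
              (1,34,0);(36,37,0);(38,39,0);(40,41,0);(42,43,-85);(44,2,-1000)])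
             (Leaf (24,1,1) [::(34,35,0);(36,37,0);(38,39,0);(40,41,0);(42,43,-1000);
              (44,2,-723)] (2,2,-1) [::(3,70,0);(72,73,0);(74,75,0);(4,5,3);(6,7,1000);
              (8,9,1000);(10,11,1000);(12,13,1000);(14,16,1000);(18,19,1000);(20,21,1000);
              (22,23,1000)])))
           (SplitW 13889 20786
            (Leaf (38,39,-1) [::(40,41,0);(42,2,-910)] (2,2,-1) [::(3,68,0);(70,71,0);(72,73,0);
              (74,75,0);(4,5,1000);(6,7,1000);(8,9,1000);(10,11,1000);(12,13,1000);(14,15,1000);
              (16,18,1000);(20,21,1000);(22,24,220);(1,37,0)])
            (Leaf (4,5,1) [::(6,7,67);(8,9,1000);(10,11,1000);(12,13,1000);
              (14,15,1000)] (16,18,1) [::(20,21,1000);(22,24,458);(1,37,0);(38,39,0);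
              (40,41,-359);(42,2,-601);(2,2,-1000);(3,68,0);(70,71,0);(72,73,0);(74,75,0)]))))
         (SplitX
          (Leaf (2,2,-1) [::(3,71,0);(72,73,0)] (74,75,1) [::(4,5,646);(6,7,1000);(8,9,1000);
            (10,11,1000);(12,13,1000);(14,15,1000);(16,17,1000);(18,19,1000);(20,21,1000);
              (22,23,1000);(24,25,908);(26,30,0);(34,35,0);(36,37,0);(38,39,0);(40,41,0);
              (42,43,-836)])
          (Leaf (2,2,-1) [::(3,69,0);(70,71,0);(72,73,0)] (74,75,1) [::(4,5,0);(6,7,728);
            (8,9,1000);(10,11,1000);(12,13,1000);(14,15,1000);(16,17,1000);(18,19,1000);
              (20,21,1000);(22,23,1000);(24,1,0);(38,39,0);(40,41,0);(42,2,-725)])))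
        (SplitX
         (SplitY
          (SplitX
           (SplitY
            (SplitW 13889 20786
             (SplitX
              (Leaf (40,41,-1) [::(42,41,-957)] (2,2,-1) [::(3,65,0);(66,67,0);(68,69,0);
              (70,71,0);(72,73,0);(74,75,115);(4,5,1000);(6,7,1000);(8,9,1000);(10,11,1000);
              (12,13,1000);(14,15,1000);(16,21,479);(1,1,0);(38,39,0)])
              (Leaf (2,2,-1) [::(3,65,0);(66,67,0);(68,69,0);(70,71,0);
              (72,73,0)] (74,75,1) [::(4,5,571);(6,7,1000);(8,9,1000);(10,11,1000);(12,13,1000);
              (14,15,1000);(16,21,448);(1,39,0);(40,41,-841)]))
             (SplitY
              (Leaf (66,67,-1) [::(68,69,0);(70,71,0);(72,73,0);(74,75,0);(4,5,0);
              (6,7,326)] (8,9,1) [::(10,11,1000);(12,13,1000);(14,15,1000);(16,0,544);(1,39,0);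
              (40,41,-610);(2,2,-1000);(3,64,0)])
              (Leaf (2,2,-1) [::(3,65,0);(66,67,0);(68,69,0);(70,71,0);
              (72,73,0)] (74,75,1) [::(4,5,0);(6,7,0);(8,9,543);(10,11,1000);(12,13,1000);
              (14,15,1000);(16,17,1000);(18,19,1000);(20,21,1000);(22,23,227);(1,39,0);
              (40,41,-539)])))
            (Leaf (2,2,-1) [::(3,67,0);(68,69,0);(70,71,0);(72,73,0)] (74,75,1) [::(4,5,0);
              (6,7,576);(8,9,1000);(10,11,1000);(12,13,1000);(14,15,1000);(16,17,1000);
              (18,19,1000);(20,21,1000);(22,24,171);(1,39,0);(40,41,-658)]))
           (SplitW 13889 20786
            (SplitX
             (Leaf (2,2,-1) [::(3,65,0);(66,67,0);(68,69,0);(70,71,0);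
              (72,73,0)] (74,75,1) [::(4,5,531);(6,7,1000);(8,9,1000);(10,11,1000);(12,13,1000);
              (14,15,1000);(16,17,1000);(18,22,338);(1,39,-172);(40,2,-692)])
             (Leaf (1,40,-1) [::] (2,2,-1) [::(3,65,0);(66,67,0);(68,69,0);(70,71,0);(72,73,0);
              (74,75,0);(4,5,491);(6,7,1000);(8,9,1000);(10,11,1000);(12,13,1000);(14,15,1000);
              (16,17,1000);(18,22,320)]))
            (Leaf (1,40,-1) [::] (2,2,-1) [::(3,65,-170);(66,67,0);(68,69,0);(70,71,0);(72,73,0);
              (74,75,0);(4,5,0);(6,7,0);(8,9,851);(10,11,1000);(12,13,1000);(14,15,1000);
              (16,17,1000);(18,22,439)])))
          (SplitX
           (Leaf (2,2,-1) [::(3,68,0);(70,71,0);(72,73,0);(74,75,0);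
             (4,5,192)] (6,7,1) [::(8,9,1000);(10,11,1000);(12,13,1000);(14,15,1000);
              (16,17,1000);(18,19,1000);(20,21,1000);(22,23,775);(24,26,0);(1,38,0);(40,41,-592)])
           (Leaf (1,40,-1) [::] (2,2,-1) [::(3,67,0);(68,69,0);(70,71,0);(72,73,0);(74,75,0);
             (4,5,0);(6,7,465);(8,9,1000);(10,11,1000);(12,13,1000);(14,15,1000);(16,17,1000);
              (18,19,1000);(20,21,1000);(22,23,719);(24,26,0)])))
         (Leaf (1,1,-1) [::] (2,2,-1) [::(3,65,0);(68,69,0);(70,71,0);(72,73,0);(74,75,0);
           (4,5,0);(6,7,397);(8,9,1000);(10,11,1000);(12,13,1000);(14,15,1000);(16,17,1000);
             (18,23,310)])))
       (SplitX
        (Leaf (38,39,-1) [::(40,42,-411)] (2,2,-1) [::(3,72,0);(74,75,0);(4,5,0);(6,7,654);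
          (8,9,1000);(10,11,1000);(12,13,1000);(14,15,1000);(16,17,1000);(18,19,1000);
            (20,21,1000);(22,23,919);(24,25,0);(26,27,0);(28,32,0);(36,37,0)])
        (SplitX
         (SplitX
          (Leaf (28,33,1) [::(38,39,-1000);(40,41,-278)] (2,2,-1) [::(3,3,0);(70,71,0);(72,73,0);
            (74,75,0);(4,5,0);(6,7,248);(8,9,1000);(10,11,1000);(12,13,1000);(14,15,1000);
              (16,17,1000);(18,19,1000);(20,21,0);(22,23,0);(24,25,0);(26,27,0)])
          (SplitX
           (Leaf (28,1,-1) [::(40,2,-357)] (2,2,-1) [::(3,69,0);(70,71,0);(72,73,0);(74,75,0);
             (4,5,0);(6,7,0);(8,9,1000);(10,11,1000);(12,13,1000);(14,15,1000);(16,17,1000);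
              (18,19,1000);(20,21,1000);(22,23,230);(24,25,0);(26,27,0)])
           (Leaf (1,40,-1) [::] (2,2,-1) [::(3,69,0);(70,71,0);(72,73,0);(74,75,0);(4,5,0);
             (6,7,465);(8,9,1000);(10,11,1000);(12,13,1000);(14,15,1000);(16,17,1000);
              (18,19,1000);(20,21,1000);(22,23,719);(24,25,0);(26,27,0);(28,30,0)])))
         (Leaf (1,1,-1) [::] (2,2,-1) [::(3,68,0);(70,71,0);(72,73,0);(74,75,0);(4,5,0);
           (6,7,465);(8,9,1000);(10,11,1000);(12,13,1000);(14,15,1000);(16,17,1000);(18,19,1000);
             (20,21,1000);(22,23,719);(24,25,0);(26,29,0)]))))
      (Leaf (2,2,-1) [::(3,72,0)] (74,75,1) [::(4,5,0);(6,7,0);(8,9,0);(10,11,707);(12,13,1000);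
        (14,15,1000);(16,17,1000);(18,19,1000);(20,21,0);(22,23,0);(24,25,0);(26,27,0);(28,29,0);
          (30,31,0);(32,40,-179)]))
     (Leaf (2,2,-1) [::(3,73,0)] (74,75,1) [::(4,5,0);(6,7,0);(8,9,0);(10,11,0);(12,13,0);
       (14,15,0);(16,17,0);(18,19,0);(20,21,0);(22,23,0);(24,25,0);(26,27,0);(28,29,0);(30,31,0);
         (32,33,0);(34,35,0);(36,37,0);(38,40,0)]))
    (SplitX
     (Leaf (1,1,-1) [::] (2,2,-1) [::(3,71,0);(74,75,0);(4,5,0);(6,7,236);(8,9,1000);
       (10,11,1000);(12,13,1000);(14,15,1000);(16,17,1000);(18,19,752);(20,31,211)])
     (Leaf (1,1,-1) [::] (2,2,-1) [::(3,69,0);(72,73,0);(74,75,0);(4,5,0);(6,7,0);(8,9,1000);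
       (10,11,1000);(12,13,1000);(14,15,1000);(16,17,1000);(18,19,779);(20,21,0);(22,31,198)])))
   (SplitX
    (SplitY
     (SplitY
      (SplitY
       (SplitX
        (SplitY
         (SplitY
          (SplitX
           (SplitW 4877 24519
            (SplitW 7257 23923
             (Leaf (0,22,1) [::(1,35,0);(36,37,0);(38,39,0);
              (40,41,0)] (42,43,-1) [::(44,45,-598);(2,2,-1000);(3,69,-69);(70,71,0);(72,73,0);
              (74,75,0);(4,5,0);(6,7,0);(8,9,0);(10,12,1000)])
             (SplitW 6074 24250
              (SplitX
               (SplitX
                (Leaf (0,22,1) [::(1,1,0);(34,35,0);(36,37,0);(38,39,0);
              (40,41,0)] (42,43,-1) [::(44,45,-741);(2,2,-1000);(3,3,-84);(70,71,0);(72,73,0);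
              (74,75,0);(4,5,0);(6,7,0);(8,9,657);(10,11,1000)])
                (Leaf (0,22,1) [::(1,34,0);(36,37,0);(38,39,0);
              (40,41,0)] (42,43,-1) [::(44,45,-694);(2,2,-1000);(3,69,-189);(70,71,0);(72,73,0);
              (74,75,0);(4,5,0);(6,7,0);(8,9,0);(10,12,1000)]))
               (Leaf (0,22,1) [::(1,35,0);(36,37,0);(38,39,0);
              (40,41,0)] (42,43,-1) [::(44,2,-658);(2,2,-1000);(3,69,-212);(70,71,0);(72,73,0);
              (74,75,0);(4,5,0);(6,7,0);(8,9,0);(10,11,697);(12,13,1000)]))
              (SplitX
               (SplitX
                (Leaf (8,9,1) [::(10,11,448)] (0,22,1) [::(1,1,0);(34,35,0);(36,37,0);(38,39,0);
              (40,41,0);(42,43,0);(44,45,-345);(2,2,-1000);(3,3,0);(70,71,0);(72,73,0);(74,75,0);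
              (4,5,0);(6,7,0)])
                (Leaf (8,9,1) [::(10,12,442)] (0,22,1) [::(1,34,0);(36,37,0);(38,39,0);(40,41,0);
              (42,43,0);(44,45,-341);(2,2,-1000);(3,69,0);(70,71,0);(72,73,0);(74,75,0);(4,5,0);
              (6,7,0)]))
               (Leaf (0,22,1) [::(1,35,0);(36,37,0);(38,39,0);
              (40,41,0)] (42,43,-1) [::(44,2,-424);(2,2,-1000);(3,69,-158);(70,71,0);(72,73,0);
              (74,75,0);(4,5,0);(6,7,0);(8,9,0);(10,11,468);(12,13,588)]))))
            (Leaf (4,5,1) [::(6,7,0);(8,9,0);(10,12,49)] (0,22,1) [::(1,35,0);(36,37,0);
              (38,39,0);(40,41,0);(42,43,0);(44,45,-38);(2,2,-1000);(3,69,0);(70,71,0);(72,73,0);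
              (74,75,0)]))
           (SplitY
            (SplitW 4877 24519
             (SplitW 7257 23923
              (Leaf (0,0,1) [::(1,37,0)] (38,39,-1) [::(40,41,0);(42,43,-896);(2,2,-1000);
              (3,66,-580);(68,69,0);(70,71,0);(72,73,0);(74,75,0);(4,5,0);(6,7,0);(8,9,510);
              (10,11,1000);(12,14,1000)])
              (Leaf (0,0,1) [::(1,37,0)] (38,39,-1) [::(40,41,0);(42,43,-578);(2,2,-1000);
              (3,66,-486);(68,69,0);(70,71,0);(72,73,0);(74,75,0);(4,5,0);(6,7,0);(8,9,0);
              (10,11,0);(12,14,928)]))
             (Leaf (0,0,1) [::(1,37,0)] (38,39,-1) [::(40,41,0);(42,43,0);(2,2,-1000);(3,66,0);
              (68,69,0);(70,71,0);(72,73,0);(74,75,0);(4,5,0);(6,7,0);(8,9,0);(10,11,0);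
              (12,14,0)]))
            (SplitW 4877 24519
             (Leaf (68,69,-1) [::(70,71,0);(72,73,0);(74,75,0);(4,5,0);(6,7,0);(8,9,0);
              (10,11,317);(12,13,1000)] (14,0,1) [::(22,23,627);(1,37,0);(38,39,0);(40,41,0);
              (42,43,-417);(2,2,-1000);(3,67,0)])
             (Leaf (70,71,-1) [::(72,73,0);(74,75,0);(4,5,0);(6,7,0);(8,9,0);(10,11,0);
              (12,13,0)] (14,0,1) [::(22,23,991);(1,37,0);(38,39,0);(40,41,0);(42,43,-152);
              (2,2,-1000);(3,67,0);(68,69,0)]))))
          (SplitX
           (SplitX
            (SplitY
             (SplitW 4877 24519
              (Leaf (4,5,1) [::(6,7,0);(8,9,0);(10,11,306);(12,0,1000);
              (20,21,1000)] (22,23,1) [::(24,1,790);(1,33,0);(34,35,0);(36,37,0);(38,39,0);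
              (40,41,0);(42,43,0);(44,45,-445);(2,2,-1000);(3,3,0);(70,71,0);(72,73,0);(74,75,0)])
              (SplitY
               (Leaf (38,39,-1) [::(40,41,0);(42,43,0);(44,45,0)] (2,2,-1) [::(3,3,0);(70,71,0);
              (72,73,0);(74,75,0);(4,5,0);(6,7,0);(8,9,0);(10,11,0);(12,13,0);(0,0,1000);
              (20,21,1000);(22,23,1000);(24,1,1000);(1,33,0);(34,35,0);(36,37,0)])
               (SplitX
                (Leaf (38,39,-1) [::(40,41,0);(42,43,0);(44,45,0)] (2,2,-1) [::(3,71,0);
              (70,71,0);(72,73,0);(74,75,0);(4,5,0);(6,7,0);(8,9,0);(10,11,0);(12,13,0);
              (0,19,1000);(20,21,1000);(22,23,1000);(24,25,1000);(1,1,0);(32,33,0);(34,35,0);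
              (36,37,0)])
                (Leaf (14,0,1) [::(20,21,1000);(22,23,1000);(24,1,788);
              (1,33,0)] (34,35,1) [::(36,37,0);(38,39,0);(40,41,0);(42,43,0);(44,2,-138);
              (2,2,-1000);(3,3,0);(70,71,0);(72,73,0);(74,75,0);(4,5,0);(6,7,0);(8,9,0);
              (10,11,0);(12,13,0)]))))
             (SplitY
              (SplitW 4877 24519
               (Leaf (2,2,-1) [::(3,71,0);(72,73,0)] (74,75,1) [::(4,5,0);(6,7,0);(8,9,0);
              (10,11,489);(12,15,1000);(18,19,1000);(20,21,1000);(22,23,1000);(24,25,514);
              (1,32,0);(34,35,0);(36,37,0);(38,39,0);(40,41,0);(42,43,0);(44,45,-427)])
               (Leaf (72,73,-1) [::(74,75,0);(4,5,0);(6,7,0);(8,9,0);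
              (10,11,0)] (12,15,1) [::(18,19,1000);(20,21,1000);(22,23,1000);(24,25,908);
              (1,32,0);(34,35,0);(36,37,0);(38,39,0);(40,41,0);(42,43,0);(44,45,-202);
              (2,2,-1000);(3,71,0)]))
              (SplitW 4877 24519
               (Leaf (26,1,1) [::(34,35,0);(36,37,0);(38,39,0);(40,41,0);(42,43,0);
              (44,2,-481)] (2,2,-1) [::(3,71,0);(72,73,0);(74,75,0);(4,5,0);(6,7,0);(8,9,0);
              (10,11,1000);(12,13,1000);(14,16,1000);(18,19,1000);(20,21,1000);(22,23,1000);
              (24,25,1000)])
               (Leaf (26,1,1) [::(34,35,0);(36,37,0);(38,39,0);(40,41,0);(42,43,0);
              (44,2,-129)] (2,2,-1) [::(3,71,0);(72,73,0);(74,75,0);(4,5,0);(6,7,0);(8,9,0);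
              (10,11,0);(12,13,247);(14,16,1000);(18,19,1000);(20,21,1000);(22,23,1000);
              (24,25,1000)]))))
            (SplitW 4877 24519
             (Leaf (74,75,1) [::(4,5,0);(6,7,0);(8,9,0);(10,11,140);(12,13,1000);
              (14,17,1000)] (20,21,1) [::(22,23,1000);(24,1,602);(1,34,0);(36,37,0);(38,39,0);
              (40,41,0);(42,43,-180);(44,2,-378);(2,2,-1000);(3,69,0);(70,71,0);(72,73,0)])
             (Leaf (70,71,-1) [::(72,73,0);(74,75,0);(4,5,0);(6,7,0);(8,9,0);(10,11,0);
              (12,13,0)] (14,17,1) [::(20,21,1000);(22,23,1000);(24,1,957);(1,34,0);(36,37,0);
              (38,39,0);(40,41,0);(42,43,0);(44,2,-142);(2,2,-1000);(3,69,0)])))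
           (SplitW 4877 24519
            (Leaf (4,5,1) [::(6,7,0);(8,9,0);(10,11,131);(12,13,1000);
              (14,15,1000)] (16,18,1) [::(20,21,1000);(22,24,582);(1,37,0);(38,39,0);(40,41,0);
              (42,2,-350);(2,2,-1000);(3,68,0);(70,71,0);(72,73,0);(74,75,0)])
            (Leaf (70,71,-1) [::(72,73,0);(74,75,0);(4,5,0);(6,7,0);(8,9,0);(10,11,0);(12,13,0);
              (14,15,0)] (16,18,1) [::(20,21,1000);(22,24,917);(1,37,0);(38,39,0);(40,41,0);
              (42,2,-56);(2,2,-1000);(3,68,0)]))))
         (SplitX
          (SplitW 4877 24519
           (Leaf (2,2,-1) [::(3,71,0);(72,73,0);(74,75,0);(4,5,0)] (6,7,1) [::(8,9,0);
             (10,11,442);(12,13,1000);(14,15,1000);(16,17,1000);(18,19,1000);(20,21,1000);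
              (22,23,1000);(24,25,1000);(26,30,18);(34,35,0);(36,37,0);(38,39,0);(40,41,0);
              (42,43,-334)])
           (Leaf (26,30,1) [::(34,35,0);(36,37,0);(38,39,0);(40,41,0);
             (42,43,-104)] (2,2,-1) [::(3,71,0);(72,73,0);(74,75,0);(4,5,0);(6,7,0);(8,9,0);
              (10,11,0);(12,13,201);(14,15,1000);(16,17,1000);(18,19,1000);(20,21,1000);
              (22,23,1000);(24,25,1000)]))
          (SplitY
           (Leaf (2,2,-1) [::(3,69,0);(70,71,0)] (72,73,-1) [::(74,75,0);(4,5,0);(6,7,0);(8,9,0);
             (10,11,0);(12,13,384);(14,15,1000);(16,17,1000);(18,19,1000);(20,21,1000);
              (22,23,1000);(24,26,360);(1,36,0);(38,39,0);(40,41,0);(42,2,-199)])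
           (Leaf (26,1,1) [::(38,39,0);(40,41,0);(42,2,-191)] (2,2,-1) [::(3,3,0);(70,71,0);
             (72,73,0);(74,75,0);(4,5,0);(6,7,0);(8,9,0);(10,11,0);(12,13,724);(14,15,1000);
              (16,17,1000);(18,19,1000);(20,21,1000);(22,23,1000);(24,25,1000)]))))
        (SplitX
         (SplitY
          (SplitX
           (Leaf (68,69,-1) [::(70,71,0);(72,73,0);(74,75,0);(4,5,0);(6,7,0);(8,9,0);(10,11,0);
             (12,13,0)] (14,15,1) [::(16,21,760);(1,39,-49);(40,41,-115);(2,2,-1000);(3,66,0)])
           (Leaf (1,40,-1) [::] (2,2,-1) [::(3,65,-288);(66,67,0);(68,69,0);(70,71,0);(72,73,0);
             (74,75,0);(4,5,0);(6,7,0);(8,9,0);(10,11,0);(12,13,0);(14,15,0);(16,17,1000);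
              (18,22,804)]))
          (Leaf (1,40,-1) [::] (2,2,-1) [::(3,68,0);(70,71,0);(72,73,0);(74,75,0);(4,5,0);
            (6,7,0);(8,9,0);(10,11,0);(12,13,0);(14,15,1000);(16,17,1000);(18,19,1000);
              (20,21,1000);(22,23,1000);(24,26,319)]))
         (Leaf (1,1,-1) [::] (2,2,-1) [::(3,65,-325);(68,69,0);(70,71,0);(72,73,0);(74,75,0);
           (4,5,0);(6,7,0);(8,9,0);(10,11,0);(12,13,0);(14,15,0);(16,17,1000);(18,23,795)])))
       (SplitX
        (Leaf (28,32,1) [::(36,37,0);(38,39,0);(40,42,-135)] (2,2,-1) [::(3,72,0);(74,75,0);
          (4,5,0);(6,7,0);(8,9,0);(10,11,0);(12,13,600);(14,15,1000);(16,17,1000);(18,19,1000);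
            (20,21,1000);(22,23,1000);(24,25,1000);(26,27,0)])
        (SplitX
         (Leaf (2,2,-1) [::(3,3,0);(70,71,0)] (72,73,-1) [::(74,75,0);(4,5,0);(6,7,0);(8,9,0);
           (10,11,0);(12,13,0);(14,15,517);(16,17,1000);(18,19,1000);(20,21,1000);(22,23,1000);
             (24,25,1000);(26,27,1000);(28,38,-23)])
         (Leaf (1,1,-1) [::] (2,2,-1) [::(3,68,0);(70,71,0);(72,73,0);(74,75,0);(4,5,0);(6,7,0);
           (8,9,0);(10,11,0);(12,13,464);(14,15,1000);(16,17,1000);(18,19,1000);(20,21,1000);
             (22,23,1000);(24,25,1000);(26,29,52)]))))
      (Leaf (30,31,1) [::(32,40,-36)] (2,2,-1) [::(3,72,0);(74,75,0);(4,5,0);(6,7,0);(8,9,0);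
        (10,11,0);(12,13,0);(14,15,0);(16,17,1000);(18,19,1000);(20,21,1000);(22,23,1000);
          (24,25,0);(26,27,0);(28,29,0)]))
     (Leaf (2,2,-1) [::(3,73,0)] (74,75,1) [::(4,5,0);(6,7,0);(8,9,0);(10,11,0);(12,13,0);
       (14,15,0);(16,17,0);(18,19,0);(20,21,0);(22,23,0);(24,25,0);(26,27,0);(28,29,0);(30,31,0);
         (32,33,0);(34,35,0);(36,37,0);(38,40,0)]))
    (Leaf (1,1,-1) [::] (2,2,-1) [::(3,70,-558);(74,75,0);(4,5,0);(6,7,0);(8,9,0);(10,11,0);
      (12,13,81);(14,15,1000);(16,17,1000);(18,19,1000);(20,31,787)]))))).

(** The root is the box 0 <= c1 <= 19968, |c2| <= 51200 with the first quadrant as cone. Its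
    half-sides 9984 = 2^8 * 39 and 51200 = 2^11 * 25 can be halved 8 and 11 times without
    rounding. *)
Lemma certificate_ok :
  tree_ok 2000000000 points (9984, 0) (9984, 51200) (25000, 0) (0, 25000) certificate.
Proof. by vm_cast_no_check (erefl true). Qed.

End Checker.

(** * Soundness of the checker *)

Section Semantics.
Variable R : realFieldType.
Variable d : R * R.
Local Notation zr := (@zr R).

Definition pt (f : aform) : R * R :=
  (zr f.1.1 + zr f.2 * d.1, zr f.1.2 + zr f.2 * d.2).
Definition af (f : aform) : R := zr f.1.1 + zr f.1.2 * d.1 + zr f.2 * d.2.

Lemma af_add f g : af (fadd f g) = af f + af g.
Proof. by rewrite /af /fadd /= !zE; ring. Qed.

Lemma af_scale a f : af (fscale a f) = zr a * af f.
Proof. by rewrite /af /fscale /= !zE; ring. Qed.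

Lemma af_sum s : af (fsum s) = \sum_(f <- s) af f.
Proof.
elim: s => [|f s IH]; first by rewrite big_nil /af /= !zr0 !mul0r !addr0.
by rewrite big_cons -IH -af_add.
Qed.

Lemma pt_add f g : pt (fadd f g) = ((pt f).1 + (pt g).1, (pt f).2 + (pt g).2).
Proof. by rewrite /pt /fadd /= !zE; congr (_, _); ring. Qed.

Lemma pt_scale a f : pt (fscale a f) = (zr a * (pt f).1, zr a * (pt f).2).
Proof. by rewrite /pt /fscale /= !zE; congr (_, _); ring. Qed.

Lemma zrm1 : zr (Zneg xH) = -1. Proof. by rewrite zrE. Qed.

Lemma pt_sub f g : pt (fsub f g) = vsub (pt f) (pt g).
Proof. by rewrite pt_add pt_scale /vsub zrm1 !mulN1r. Qed.

Lemma pt_sum s :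
  pt (fsum s) = (\sum_(f <- s) (pt f).1, \sum_(f <- s) (pt f).2).
Proof.
elim: s => [|f s IH]; first by rewrite !big_nil /pt /= !zr0 !mul0r !addr0.
by rewrite !big_cons /= pt_add -/(fsum s) IH.
Qed.

Lemma af_cross f g : af (fcross f g) = cross (pt f) (pt g).
Proof. by rewrite /af /cross /pt /fcross /= !zE; ring. Qed.

Variable h : Z * Z.
Hypotheses (hd1 : `|d.1| <= zr h.1) (hd2 : `|d.2| <= zr h.2).

Lemma af_mag f : `|af f - zr f.1.1| <= zr (fmag h f).
Proof.
rewrite /af /fmag !zE.
rewrite (_ : _ - _ = zr f.1.2 * d.1 + zr f.2 * d.2); last by ring.
apply: le_trans (ler_normD _ _) _; rewrite !normrM.
by apply: lerD; apply: ler_wpM2l.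
Qed.

Lemma fmin_le f : zr (fmin h f) <= af f.
Proof. by move: (af_mag f); rewrite /fmin zrB ler_norml => /andP[]; lra. Qed.

Lemma fmax_ge f : af f <= zr (fmax h f).
Proof. by move: (af_mag f); rewrite /fmax zrD ler_norml => /andP[]; lra. Qed.

(** What [fmul1] drops is the product of the two linear parts, each bounded by its [fmag]. An upper
    bound is the useful side, since these products enter the leaf inequality with a minus sign. *)
Lemma fmul1_le f g :
  af f * af g <= af (fmul1 f g) + zr (Z.mul (fmag h f) (fmag h g)).
Proof.
have : (af f - zr f.1.1) * (af g - zr g.1.1) <= zr (fmag h f) * zr (fmag h g).
  apply: le_trans (ler_norm _) _; rewrite normrM.
  by apply: ler_pM => //; exact: af_mag.
rewrite zrM => H; rewrite -subr_ge0; move: H; rewrite -subr_ge0.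
congr (0 <= _); rewrite /fmul1 /af /= !zE; ring.
Qed.

End Semantics.

(** * The points attached to the edges *)

Section Witness.
Variable R : realType.

Definition slide (l w g : R * R) (t s : R) : R * R :=
  (t * (l.1 + s * w.1) + (1 - t) * g.1, t * (l.2 + s * w.2) + (1 - t) * g.2).

(** [s] will be the sign of a weight, so 0 has to be allowed; it gives the midpoint [l] of the
    segment. *)
Lemma slide_in (S : set (R * R)) l w g t s : convex_plane S ->
  S (l.1 + w.1, l.2 + w.2) -> S (l.1 - w.1, l.2 - w.2) -> S g ->
  0 <= t <= 1 -> -1 <= s <= 1 -> S (slide l w g t s).
Proof.
move=> cS S1 S2 Sg /andP[t0 t1] /andP[s0 s1].
have Sl : S (l.1 + s * w.1, l.2 + s * w.2).
  have := cS _ _ S1 S2 ((1 + s) / 2); rewrite /= => H.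
  rewrite (_ : (_, _) = ((1 + s) / 2 * (l.1 + w.1) + (1 - (1 + s) / 2) * (l.1 - w.1),
      (1 + s) / 2 * (l.2 + w.2) + (1 - (1 + s) / 2) * (l.2 - w.2))).
    by apply: H; lra.
  by congr (_, _); field.
exact: (cS _ _ Sl Sg t t0 t1).
Qed.

End Witness.

Lemma fsum_cons f s : fsum (f :: s) = fadd f (fsum s). Proof. by []. Qed.

(** * Soundness of a single leaf *)

Section LeafSound.
Variable R : realType.
Variables (d l w : R * R) (S : set (R * R)).
Hypothesis cS : convex_plane S.
Hypotheses (Sp : S (l.1 + w.1, l.2 + w.2)) (Sm : S (l.1 - w.1, l.2 - w.2)).
Hypothesis S0 : S (0, 0).
Local Notation zr := (@zr R).
Local Notation K := (zr (Zpos 1000)).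
Local Notation pt := (pt d).
Local Notation af := (af d).

Definition redge (i : item) : (R * R) * (R * R) := (pt (im i), pt (fadd (im i) (ie i))).
Definition ritem (t : R) (i : item) : (R * R) * (R * R) * (R * R) :=
  (redge i, slide l w (pt (ig i)) t (Num.sg (zr (iw i)))).

Definition term (i : (R * R) * (R * R) * (R * R)) : R := cross i.2 (vsub i.1.2 i.1.1).

Lemma redgeE i : vsub (redge i).2 (redge i).1 = pt (ie i).
Proof. by rewrite /redge /vsub pt_add [RHS]surjective_pairing; congr (_, _); rewrite /=; ring. Qed.

Lemma term_ritem t i : term (ritem t i) =
  af (ibase i) + t * (cross l (pt (ie i)) + Num.sg (zr (iw i)) * cross w (pt (ie i))
                      - af (ibase i)).
Proof. by rewrite /term redgeE af_cross /cross /slide /=; ring. Qed.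

Definition rnormal (i : item) := ritem (`|zr (iw i)| / K) i.

(** Scaling by 1000 turns the fixed weights into the integers of the certificate; the product of
    sign and absolute value of a weight gives back the signed weight in the part linear in [w]. *)
Lemma sum_normal (N : seq item) :
  K * \sum_(i <- map rnormal N) term i =
  K * af (fsum (map ibase N))
  - af (fsum (map (fun i => fscale (Z.abs (iw i)) (ibase i)) N))
  + cross l (pt (fsum (map (fun i => fscale (Z.abs (iw i)) (ie i)) N)))
  + cross w (pt (fsum (map (fun i => fscale (iw i) (ie i)) N))).
Proof.
elim: N => [|i N IH].
  by rewrite big_nil /pt /af /cross /= !zr0; ring.
rewrite !map_cons !fsum_cons big_cons mulrDr IH /rnormal term_ritem.
rewrite !af_add !pt_add !af_scale !pt_scale zr_abs.
rewrite /cross ![(_, _).1]/= ![(_, _).2]/=.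
have := numEsg (zr (iw i)).
move: (Num.sg (zr (iw i))) `|zr (iw i)| => u a ->.
by field; rewrite gt_eqF// zr_pos.
Qed.

Variables (h : Z * Z).
Hypotheses (hd1 : `|d.1| <= zr h.1) (hd2 : `|d.2| <= zr h.2).

Lemma left_of_sound i j : left_of h i j -> edge_left (redge i) (redge j).
Proof.
rewrite /left_of /edge_left redgeE.
rewrite (_ : vsub (redge j).1 (redge i).1 = pt (fsub (im j) (im i))); last by rewrite pt_sub.
rewrite (_ : vsub (redge j).2 (redge i).1 = pt (fadd (fsub (im j) (im i)) (ie j))); last first.
  by rewrite pt_add pt_sub /vsub /redge pt_add; congr (_, _); rewrite /=; ring.
rewrite -!af_cross.
set f := fcross _ _; set g := fcross _ _.
move=> /and3P[/(@zr_le R) f0 /(@zr_le R) g0 /(@zr_lt R)].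
rewrite zrD => fg; rewrite zr0 in f0 g0 fg.
have := fmin_le hd1 hd2 f; have := fmin_le hd1 hd2 g => H1 H2.
by apply/and3P; split; lra.
Qed.

Lemma leaf_sound (A B : item) (N1 N2 : seq item) (goal : Z) (w1 w2 : Z * Z) (s t : R) :
  leaf_ok goal h w1 w2 A B N1 N2 ->
  0 <= s -> 0 <= t -> 1 <= s + t ->
  w.1 = s * zr w1.1 + t * zr w2.1 -> w.2 = s * zr w1.2 + t * zr w2.2 ->
  (forall i, i \in A :: N1 ++ B :: N2 ->
     [/\ S (redge i).1, S (redge i).2 & S (pt (ig i))]) ->
  pt (fsum (map ie (A :: N1 ++ B :: N2))) = (0, 0) ->
  mixed_area_ge S (zr goal).
Proof.
move=> + s0 t0 st1 wE1 wE2 HS Hclosed.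
rewrite /leaf_ok.
set V := fsum (map (fun i => fscale (Z.abs (iw i)) (ie i)) (N1 ++ N2)).
set W := fsum (map (fun i => fscale (iw i) (ie i)) (N1 ++ N2)).
set H := fsum (map (fun i => fscale (Z.abs (iw i)) (ibase i)) (N1 ++ N2)).
set G := fsum (map ibase (A :: _)).
set D := (fcross (ie A) (ie B)).1.1.
set TA := fcross (ie B) V; set TB := fcross V (ie A).
set P := fsum [:: fscale _ G; _; _; _]; set Q := Z.add (Z.mul (fmag h TA) _) _.
move=> /and5P[Hconv Hw /Z.eqb_eq kA /Z.eqb_eq kB].
move=> /and5P[/(@zr_lt R) D0 TA0 TA1 TB0 /and3P[TB1 good1 good2]].
rewrite zr0 in D0.
have fle := fmin_le hd1 hd2; have fge := fmax_ge hd1 hd2.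
have bounds f : Z.leb Z0 (fmin h f) -> Z.leb (fmax h f) (Z.mul 1000 D) ->
    0 <= af f <= K * zr D.
  move=> /(@zr_le R); rewrite zr0 => f0 /(@zr_le R); rewrite zrM => f1.
  by rewrite (le_trans f0 (fle f)) (le_trans (fge f)).
have cstE f : f.2 = Z0 -> pt f = (zr f.1.1, zr f.1.2).
  by rewrite /pt => ->; rewrite zr0 !mul0r !addr0.
have DE : zr D = cross (pt (ie A)) (pt (ie B)).
  by rewrite !cstE// /cross /D /fcross /= !zE.
have TAE : af TA = cross (pt (ie B)) (pt V) by rewrite af_cross.
have TBE : af TB = cross (pt V) (pt (ie A)) by rewrite af_cross.
have {TA0 TA1} TAb := bounds _ TA0 TA1.
have {TB0 TB1 bounds} TBb := bounds _ TB0 TB1.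
(* The part linear in w, times 1000 D. Being linear, it is determined by its values at the two
   generators of the cone. *)
pose f (x : R * R) := zr D * cross x (pt W)
  + (Num.sg (zr (iw A)) * cross x (pt (ie A))) * af TA
  + (Num.sg (zr (iw B)) * cross x (pt (ie B))) * af TB.
have fE (x : Z * Z) : af (wform D W TA TB A B x) = f (zr x.1, zr x.2).
  rewrite af_sum !big_cons big_nil !af_scale af_cross /f !zrM !zr_sgn.
  rewrite (cstE (x.1, x.2, Z0))// (cstE (ie A))// (cstE (ie B))//.
  by rewrite /cross /= !zE; ring.
(* The part free of l and w, times 1000 D, with the exact products that [P] replaces by their affine
   parts. *)
pose P2 := K * zr D * af G - zr D * af H - af TA * af (ibase A) - af TB * af (ibase B).
have goodE (x : Z * Z) (F := wform D W TA TB A B x) :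
    Z.leb Z0 (fmin h F) &&
    Z.leb (Z.add (Z.mul goal (Z.mul 1000 D)) Q) (fmin h (fadd P F)) ->
    0 <= f (zr x.1, zr x.2) /\
    zr goal * (K * zr D) <= P2 + f (zr x.1, zr x.2).
  move=> /andP[/(@zr_le R) g1 /(@zr_le R) g2]; rewrite -fE; split.
    by rewrite zr0 in g1; exact: le_trans g1 (fle _).
  have {g2} := le_trans g2 (fle _); rewrite af_add zrD zrM zrM -/F.
  have QA := fmul1_le hd1 hd2 TA (ibase A).
  have QB := fmul1_le hd1 hd2 TB (ibase B).
  rewrite /P af_sum !big_cons big_nil !af_scale zrN zrM zrm1 /Q zrD /P2.
  move: QA QB; lra.
have [{}good1 {}good1'] := goodE w1 good1.
have [{}good2 {}good2'] := goodE w2 good2.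
have fw : f w = s * f (zr w1.1, zr w1.2) + t * f (zr w2.1, zr w2.2).
  by rewrite /f /cross wE1 wE2 /=; ring.
(* As [f] is nonnegative at both generators and [1 <= s + t], its value at [w] is at least the
   smaller of the two; this is why the checker tests the sign of [F]. *)
have final : zr goal * (K * zr D) <= P2 + f w.
  rewrite fw; have [fl|fl] := leP (f (zr w1.1, zr w1.2)) (f (zr w2.1, zr w2.2)).
    by apply: le_trans good1' _; rewrite lerD2l; nra.
  by apply: le_trans good2' _; rewrite lerD2l; nra.
clear good1 good1' good2 good2' goodE fE fw.
pose tA := af TA / (K * zr D); pose tB := af TB / (K * zr D).
exists (ritem tA A :: map rnormal N1 ++ ritem tB B :: map rnormal N2), (0, 0).
have mapE : map fst (ritem tA A :: map rnormal N1 ++ ritem tB B :: map rnormal N2)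
    = map redge (A :: N1 ++ B :: N2).
  by rewrite /= !map_cat /= -!map_comp.
have sumE (F : (R * R) * (R * R) -> R) :
    \sum_(i <- ritem tA A :: map rnormal N1 ++ ritem tB B :: map rnormal N2) F i.1
    = \sum_(j <- A :: N1 ++ B :: N2) F (redge j).
  by rewrite -(big_map fst xpredT F) mapE big_map.
have D1 : 0 < K * zr D by apply: mulr_gt0 (zr_pos _ _) D0.
have tAb : 0 <= tA <= 1.
  by move: TAb => /andP[? ?]; rewrite /tA ler_pdivrMr// mul1r divr_ge0// ltW.
have tBb : 0 <= tB <= 1.
  by move: TBb => /andP[? ?]; rewrite /tB ler_pdivrMr// mul1r divr_ge0// ltW.
have ritem_in u i : 0 <= u <= 1 -> i \in A :: N1 ++ B :: N2 ->
    [/\ S (ritem u i).1.1, S (ritem u i).1.2 & S (ritem u i).2].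
  move=> u01 /HS[? ? ?]; split=> //; apply: slide_in => //.
  by rewrite -ler_norml normr_sg; case: (_ != _) => /=; rewrite ?lexx ?ler01.
have rnormal_in i : i \in N1 ++ N2 -> i \in A :: N1 ++ B :: N2 ->
    [/\ S (rnormal i).1.1, S (rnormal i).1.2 & S (rnormal i).2].
  move=> iN; apply: ritem_in; apply/andP; split; first by rewrite divr_ge0// ltW// zr_pos.
  move: (allP Hw i iN) => /(@zr_le R); rewrite zr_abs => ?.
  by rewrite ler_pdivrMr ?zr_pos// mul1r.
split; split.
- by [].
- move=> i; rewrite inE mem_cat inE => /or4P[/eqP ->|/mapP[j jN ->]|/eqP ->|/mapP[j jN ->]].
  + by apply: ritem_in => //; rewrite inE eqxx.
  + by apply: rnormal_in; rewrite ?inE !mem_cat jN ?orbT.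
  + by apply: ritem_in => //; rewrite inE mem_cat inE eqxx !orbT.
  + by apply: rnormal_in; rewrite ?inE !mem_cat ?inE jN ?orbT.
- rewrite mapE all_map; move: Hconv => /andP[/allP + _] => Hc.
  apply/allP => i /Hc /(@zr_lt R) /=; rewrite zr0 => Hi.
  have := lt_le_trans Hi (fle _); rewrite af_cross => ?.
  rewrite (_ : cross _ _ = cross (pt (im i)) (pt (ie i)))//.
  by rewrite pt_add /cross /vsub /=; ring.
- rewrite mapE pairwise_map; move: Hconv => /andP[_].
  apply: sub_pairwise => i j /andP[ij ji] /=.
  by apply/andP; split; apply: left_of_sound.
- rewrite (sumE (fun e => e.2.1 - e.1.1)).
  move: (congr1 fst Hclosed); rewrite pt_sum !big_map [LHS]/= [RHS]/=; apply: etrans.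
  by apply: eq_bigr => i _; exact: (congr1 fst (redgeE i)).
- rewrite (sumE (fun e => e.2.2 - e.1.2)).
  move: (congr1 snd Hclosed); rewrite pt_sum !big_map [LHS]/= [RHS]/=; apply: etrans.
  by apply: eq_bigr => i _; exact: (congr1 snd (redgeE i)).
- rewrite -(ler_pM2r D1); apply: le_trans final _.
  rewrite (_ : _ + _ = (\sum_(i <- ritem tA A :: map rnormal N1 ++ ritem tB B :: map rnormal N2)
      term i) * (K * zr D))//.
  have GE : af G = af (ibase A) + af (ibase B) + af (fsum (map ibase (N1 ++ N2))).
    rewrite !af_sum !big_map big_cons !big_cat big_cons /=; ring.
  rewrite big_cons big_cat big_cons /=.
  have := sum_normal (N1 ++ N2); rewrite -/V -/W -/H [map rnormal _]map_cat big_cat /=.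
  set S1 := \sum_(i <- map _ N1) _; set S2 := \sum_(i <- map _ N2) _ => SE.
  have tAE : tA * (K * zr D) = af TA by rewrite /tA divfK// gt_eqF.
  have tBE : tB * (K * zr D) = af TB by rewrite /tB divfK// gt_eqF.
  rewrite !term_ritem.
  (* The planar identity cross(a, b) v + cross(b, v) a + cross(v, a) b = 0, paired with [l]: the two
     solved weights cancel every occurrence of [l]. *)
  have cramer : zr D * cross l (pt V) + af TA * cross l (pt (ie A))
      + af TB * cross l (pt (ie B)) = 0.
    by rewrite DE TAE TBE /cross; ring.
  rewrite /P2 /f GE -[LHS]addr0 -cramer.
  set uA := _ + _ - af (ibase A); set uB := _ + _ - af (ibase B).
  rewrite [RHS](_ : _ = af (ibase A) * (K * zr D) + tA * (K * zr D) * uA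
    + af (ibase B) * (K * zr D) + tB * (K * zr D) * uB + zr D * (K * (S1 + S2))); last by ring.
  by rewrite tAE tBE SE /uA /uB; ring.
Qed.

End LeafSound.

Definition point_ok (p : aform) : bool :=
  if Z.eqb p.2 Z0 then Z.leb (Z.abs p.1.1) 8635 && Z.leb (Z.abs p.1.2) 16365
  else Z.eqb p.2 1 &&
       Z.leb (Z.add (Z.mul p.1.1 p.1.1) (Z.mul p.1.2 p.1.2)) 253128100.

Lemma points_ok : all point_ok points.
Proof. by vm_compute. Qed.

Lemma znth_ok s i : all point_ok s -> point_ok (znth s i).
Proof.
elim: s i => //= p s IH i /andP[pp ps]; case: ifP => // _; exact: IH.
Qed.

(** * Soundness of the tree *)

Section TreeSound.
Variable R : realType.
Local Notation zr := (@zr R).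
Variables (S : set (R * R)) (c l w : R * R).
Variable pts : seq aform.
Hypothesis pts_ok : all point_ok pts.
Hypothesis cS : convex_plane S.
Hypothesis SR : forall p, `|p.1| <= zr 8635 -> `|p.2| <= zr 16365 -> S p.
Hypothesis SC : forall u, u.1 ^+ 2 + u.2 ^+ 2 <= zr 253128100 ->
  S (c.1 + u.1, c.2 + u.2).
Hypotheses (Sp : S (l.1 + w.1, l.2 + w.2)) (Sm : S (l.1 - w.1, l.2 - w.2)).
Hypothesis wN : w.1 ^+ 2 + w.2 ^+ 2 = zr 625000000.

(** Generators of squared length at most [N] give a combination of squared length at most
    [N * (s + t) ^+ 2]. This is why cutting directions are rounded into the disk of radius 25000. *)
Lemma cone_ge1 (a b x y s t N : R) : 0 < N -> 0 <= s -> 0 <= t ->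
  (s * a + t * x) ^+ 2 + (s * b + t * y) ^+ 2 = N ->
  a ^+ 2 + b ^+ 2 <= N -> x ^+ 2 + y ^+ 2 <= N -> 1 <= s + t.
Proof.
move=> N0 s0 t0 E n1 n2.
have ip : a * x + b * y <= N.
  have := sqr_ge0 (a - x); have := sqr_ge0 (b - y); rewrite !sqrrB; lra.
have : N <= N * (s + t) ^+ 2.
  rewrite -{1}E (_ : _ + _ = s ^+ 2 * (a ^+ 2 + b ^+ 2) + 2 * (s * t) * (a * x + b * y)
    + t ^+ 2 * (x ^+ 2 + y ^+ 2)); last by ring.
  rewrite (_ : N * _ = s ^+ 2 * N + 2 * (s * t) * N + t ^+ 2 * N); last by ring.
  apply: lerD; last by rewrite ler_wpM2l// sqr_ge0.
  by apply: lerD; rewrite ler_wpM2l// ?sqr_ge0// !mulr_ge0.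
rewrite ler_pMr// => H.
by rewrite -(@ler_pXn2r _ 2) ?expr1n// ?nnegrE ?addr_ge0.
Qed.

Let dl (C : Z * Z) : R * R := (c.1 - zr C.1, c.2 - zr C.2).

Lemma vertex_in C i : S (pt (dl C) (vertex pts C i)).
Proof.
rewrite /vertex; move: (znth pts i) (znth_ok i pts_ok) => [[x y] k].
rewrite /point_ok /= /pt /=; case: ifP => [/Z.eqb_eq ->|_].
  move=> /andP[/(@zr_le R) hx /(@zr_le R) hy].
  rewrite !zrD !Z.mul_0_l zr0 !mul0r !addr0.
  by apply: SR; rewrite /= -zr_abs.
move=> /andP[/Z.eqb_eq -> /(@zr_le R)]; rewrite !zE => H.
rewrite (_ : (_, _) = (c.1 + zr x, c.2 + zr y)); last by rewrite /dl /=; congr (_, _); ring.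
by have := SC (u := (zr x, zr y)); rewrite /= !expr2; apply.
Qed.

Lemma origin_in : S (0, 0).
Proof. by apply: SR; rewrite /= normr0 ltW// zr_pos. Qed.

Lemma mkitem_in C x y (i := mkitem pts C x y) :
  [/\ S (redge (dl C) i).1, S (redge (dl C) i).2 & S (pt (dl C) (ig i))].
Proof.
split; [exact: vertex_in | | exact: vertex_in].
rewrite /redge /= pt_add pt_sub /vsub /=.
move: (vertex_in C y.1.1); rewrite /pt.
by congr (S (_, _)); rewrite /=; ring.
Qed.

Lemma mem_mkitems C s nxt i : i \in mkitems pts C s nxt ->
  exists x y, i = mkitem pts C x y.
Proof.
elim: s => //= x s IH; rewrite inE => /orP[/eqP ->|/IH //].
by exists x, (head nxt s).
Qed.

Lemma pt_ie C x y : pt (dl C) (ie (mkitem pts C x y)) =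
  vsub (pt (dl C) (vertex pts C y.1.1)) (pt (dl C) (vertex pts C x.1.1)).
Proof. exact: pt_sub. Qed.

(** The edges telescope, so the two chains of a leaf together with the edges A and B close up. *)
Lemma sum_mkitems C s nxt (v := fun x : entry => pt (dl C) (vertex pts C x.1.1)) :
  pt (dl C) (fsum (map ie (mkitems pts C s nxt))) = vsub (v nxt) (v (head nxt s)).
Proof.
elim: s => [|x s IH] /=.
  by rewrite /vsub !subrr /pt /= zr0 !mul0r !addr0.
rewrite pt_add IH pt_sub /vsub /=; congr (_, _); ring.
Qed.

Lemma pt_cat (d : R * R) s1 s2 : pt d (fsum (s1 ++ s2)) =
  ((pt d (fsum s1)).1 + (pt d (fsum s2)).1, (pt d (fsum s1)).2 + (pt d (fsum s2)).2).
Proof. by rewrite !pt_sum !big_cat. Qed.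

Lemma halfZ_ge h : zr h <= zr (halfZ h) + zr (halfZ h).
Proof.
rewrite -zrD; apply: zr_le; rewrite /halfZ.
have := Z.mul_succ_div_gt (Z.add h 1) 2 erefl; lia.
Qed.

Lemma split_box (x a : R) h : `|x - a| <= zr h ->
  `|x - (a - zr (halfZ h))| <= zr (halfZ h) \/ `|x - (a + zr (halfZ h))| <= zr (halfZ h).
Proof.
have := halfZ_ge h; move: (zr (halfZ h)) (zr h) => q r qr.
rewrite !ler_norml => /andP[? ?].
by have [?|?] := leP x a; [left|right]; apply/andP; split; lra.
Qed.

Lemma tree_sound goal t C h w1 w2 : tree_ok goal pts C h w1 w2 t ->
  `|c.1 - zr C.1| <= zr h.1 -> `|c.2 - zr C.2| <= zr h.2 ->
  zr w1.1 ^+ 2 + zr w1.2 ^+ 2 <= zr 625000000 ->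
  zr w2.1 ^+ 2 + zr w2.2 ^+ 2 <= zr 625000000 ->
  0 <= cross (zr w1.1, zr w1.2) w -> 0 <= cross w (zr w2.1, zr w2.2) ->
  mixed_area_ge S (zr goal).
Proof.
elim: t C h w1 w2 => [t1 IH1 t2 IH2|t1 IH1 t2 IH2|x y t1 IH1 t2 IH2|a s1 b s2] C h w1 w2 /=.
- move=> /andP[/IH1 {}IH1 /IH2 {}IH2] /split_box[H|H] h2 n1 n2 x1 x2.
    by apply: IH1 => //=; rewrite zrB.
  by apply: IH2 => //=; rewrite zrD.
- move=> /andP[/IH1 {}IH1 /IH2 {}IH2] h1 /split_box[H|H] n1 n2 x1 x2.
    by apply: IH1 => //=; rewrite zrB.
  by apply: IH2 => //=; rewrite zrD.
- move=> /and3P[/(@zr_le R) n /IH1 {}IH1 /IH2 {}IH2] h1 h2 n1 n2 x1 x2.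
  rewrite !zE -!expr2 in n.
  have [H|H] := leP 0 (cross w (zr x, zr y)); first exact: IH1.
  apply: IH2 => //=; move: H; rewrite /cross /=; lra.
- move=> /andP[/(@zr_lt R)]; rewrite zr0 zrB !zrM => D0 ok h1 h2 n1 n2 x1 x2.
  set D := _ - _ in D0.
  (* Cramer's rule for writing [w] in terms of the generators; the signs come from [w] lying in the
     cone. *)
  pose s := cross w (zr w2.1, zr w2.2) / D; pose t := cross (zr w1.1, zr w1.2) w / D.
  have s0 : 0 <= s by rewrite divr_ge0// ltW.
  have t0 : 0 <= t by rewrite divr_ge0// ltW.
  have D0' : D != 0 by rewrite gt_eqF.
  have e1 : w.1 = s * zr w1.1 + t * zr w2.1.
    by rewrite /s /t /cross /=; move: D0'; rewrite /D => D0'; field.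
  have e2 : w.2 = s * zr w1.2 + t * zr w2.2.
    by rewrite /s /t /cross /=; move: D0'; rewrite /D => D0'; field.
  apply: (@leaf_sound R (dl C) l w S cS Sp Sm origin_in h h1 h2 _ _ _ _ _ _ _ s t ok) => //.
  + move: wN n1 n2; rewrite e1 e2; move: (zr 625000000) (zr_pos R 625000000).
    by move=> N N0; exact: cone_ge1 N0 s0 t0.
  + move=> i; rewrite inE mem_cat inE .
    move=> /or4P[/eqP ->|/mem_mkitems[x [y ->]]|/eqP ->|/mem_mkitems[x [y ->]]];
      exact: mkitem_in.
  + rewrite map_cons map_cat map_cons fsum_cons (pt_add _ (ie (mkitem _ _ _ _))).
    rewrite pt_cat fsum_cons (pt_add _ (ie (mkitem _ _ _ _))) !sum_mkitems !pt_ie /vsub.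
    rewrite [in LHS]/=.
    by congr (_, _); ring.
Qed.

End TreeSound.

(** * The three shapes *)

Section FrameBound.
Variable R : realType.
Local Notation zr := (@zr R).
Variables (S : set (R * R)).
Hypothesis cS : convex_plane S.

(** The polygon is the rectangle itself, and each of its sides contributes its length times the
    outward coordinate of the attached point. *)
Lemma rectangle_mixed_area (a b : R) (z1 z2 z3 z4 : R * R) : 0 < a -> 0 < b ->
  (forall p, `|p.1| <= a -> `|p.2| <= b -> S p) ->
  S z1 -> S z2 -> S z3 -> S z4 ->
  mixed_area_ge S (2 * a * z1.2 - 2 * b * z2.1 - 2 * a * z3.2 + 2 * b * z4.1).
Proof.
move=> a0 b0 SR S1 S2 S3 S4.
have ab : 0 < a * b by exact: mulr_gt0.
have na : `|a| <= a by rewrite gtr0_norm.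
have nb : `|b| <= b by rewrite gtr0_norm.
exists [:: (((a, b), (- a, b)), z1); (((- a, b), (- a, - b)), z2);
           (((- a, - b), (a, - b)), z3); (((a, - b), (a, b)), z4)], (0, 0).
split; split.
- by apply: SR; rewrite /= normr0 ltW.
- by move=> i; rewrite !inE => /or4P[] /eqP ->; split=> //=; apply: SR; rewrite /= ?normrN.
- by rewrite /cross /vsub /= !subr0; apply/and5P; split=> //; lra.
- rewrite /= /edge_left /cross /vsub /=; repeat (apply/andP; split); by [] || lra.
- by rewrite !big_cons big_nil /=; ring.
- by rewrite !big_cons big_nil /=; ring.
- by rewrite !big_cons big_nil /cross /vsub /= le_eqVlt; apply/orP; left; apply/eqP; ring.
Qed.

Lemma frame_bound (c l w : R * R) :
  (forall p, `|p.1| <= zr 8635 -> `|p.2| <= zr 16365 -> S p) ->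
  (forall u, u.1 ^+ 2 + u.2 ^+ 2 <= zr 253128100 -> S (c.1 + u.1, c.2 + u.2)) ->
  S (l.1 + w.1, l.2 + w.2) -> S (l.1 - w.1, l.2 - w.2) ->
  w.1 ^+ 2 + w.2 ^+ 2 = zr 625000000 ->
  0 <= c.1 -> 0 <= w.1 -> 0 <= w.2 -> mixed_area_ge S (zr 2000000000).
Proof.
move=> SR SC Sp Sm wN c0 w10 w20.
have SS : S (0, 0) by apply: SR; rewrite /= normr0 ltW// zr_pos.
have mono v v' : v' <= v -> mixed_area_ge S v -> mixed_area_ge S v'.
  move=> vv [s] [q] [H1] [H2 H3 H4]; exists s, q; split=> //; split=> //.
  exact: le_trans vv H4.
have a0 := zr_pos R 8635; have b0 := zr_pos R 16365; have r0 := zr_pos R 15910.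
set a := zr 8635 in SR a0; set b := zr 16365 in SR b0; set r := zr 15910 in r0.
have Sa : S (a, 0) by apply: SR; rewrite /= ?normr0 ?(gtr0_norm a0)// ltW.
have Sa' : S (- a, 0) by apply: SR; rewrite /= ?normrN ?normr0 ?(gtr0_norm a0)// ltW.
have Sb : S (0, b) by apply: SR; rewrite /= ?normr0 ?(gtr0_norm b0)// ltW.
have Sb' : S (0, - b) by apply: SR; rewrite /= ?normrN ?normr0 ?(gtr0_norm b0)// ltW.
have rE : r ^+ 2 = zr 253128100 by rewrite expr2 -zrM.
have Sx : S (c.1 + r, c.2).
  by have := SC (r, 0); rewrite /= rE expr0n /= !addr0; apply.
have Sy : S (c.1, c.2 + r).
  by have := SC (0, r); rewrite /= rE expr0n /= !add0r !addr0; apply.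
have Sy' : S (c.1, c.2 - r).
  by have := SC (0, - r); rewrite /= sqrrN rE expr0n /= !add0r !addr0; apply.
have rect := rectangle_mixed_area a0 b0 SR.
have z6 : zr 6 = 6 by rewrite zrE.
have z2 : zr 2 = 2 by rewrite zrE.
(* The extreme point of the disk already suffices from about c1 = 19292 and |c2| = 50803 on; the
   thresholds 19968 and 51200 are slightly larger and divisible by high powers of 2. *)
have num1 : zr 2000000000 <= 6 * (a * b) + 2 * (b * (zr 19968 + r)).
  have := @zr_le R 2000000000 (Z.add (Z.mul 6 (Z.mul 8635 16365))
    (Z.mul 2 (Z.mul 16365 (Z.add 19968 15910)))) erefl.
  by rewrite !zrD !zrM !zrD z6 z2.
have num2 : zr 2000000000 <= 6 * (a * b) + 2 * (a * (zr 51200 + r)).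
  have := @zr_le R 2000000000 (Z.add (Z.mul 6 (Z.mul 8635 16365))
    (Z.mul 2 (Z.mul 8635 (Z.add 51200 15910)))) erefl.
  by rewrite !zrD !zrM !zrD z6 z2.
(* Far out, three sides of the rectangle get their own midpoints and the side facing the disk gets
   the extreme point of the disk. *)
have [c1|c1] := ltP (zr 19968) c.1.
  apply: mono (rect _ _ _ _ Sb Sa' Sb' Sx) => /=.
  have : b * (zr 19968 + r) <= b * (c.1 + r) by rewrite ler_wpM2l ?(ltW b0)// lerD2r ltW.
  lra.
have [c2|c2] := ltP (zr 51200) c.2.
  apply: mono (rect _ _ _ _ Sy Sa' Sb' Sa) => /=.
  have : a * (zr 51200 + r) <= a * (c.2 + r) by rewrite ler_wpM2l ?(ltW a0)// lerD2r ltW.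
  lra.
have [c2'|c2'] := ltP c.2 (- zr 51200).
  apply: mono (rect _ _ _ _ Sb Sa' Sy' Sa) => /=.
  have : a * (zr 51200 + r) <= a * (- c.2 + r).
    by rewrite ler_wpM2l ?(ltW a0)// lerD2r lerNr ltW.
  lra.
have dbl : zr 19968 = zr 9984 + zr 9984 by rewrite -zrD.
have sq : zr 25000 ^+ 2 = zr 625000000 by rewrite expr2 -zrM.
have p0 := zr_pos R 25000.
rewrite dbl in c1.
apply: (tree_sound points_ok cS SR SC Sp Sm wN certificate_ok); rewrite /= ?zr0.
- by rewrite ler_norml; apply/andP; split; lra.
- by rewrite subr0 ler_norml; apply/andP; split.
- by rewrite expr0n addr0 sq.
- by rewrite expr0n add0r sq.
- by rewrite /cross /= mul0r subr0 mulr_ge0// ltW.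
- by rewrite /cross /= mulr0 subr0 mulr_ge0// ltW.
Qed.

End FrameBound.

(** * An upper bound for pi *)

Section PiBound.
Variable R : realType.

Lemma atan_le_id (x : R) : 0 <= x -> atan x <= x.
Proof.
rewrite le_eqVlt => /orP[/eqP <-|x0]; first by rewrite atan0.
have [|c _] := @MVT R (@atan R) (fun y => (1 + y ^+ 2)^-1) 0 x x0 (fun y _ => is_derive1_atan y).
  by apply: continuous_subspaceT => y; exact: continuous_atan.
rewrite atan0 !subr0 => ->.
by rewrite ler_piMl ?(ltW x0)// invf_le1 ?lerDl ?sqr_ge0// ltr_wpDr// sqr_ge0.
Qed.

Lemma atan_double (x : R) : 0 < x < 1 -> atan (2 * x / (1 - x ^+ 2)) = 2 * atan x.
Proof.
move=> /andP[x0 x1].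
have a0 : 0 < atan x by rewrite -(@atan0 R) lt_atan.
have a1 : atan x < pi / 4 by rewrite -(@atan1 R) lt_atan.
have -> : 2 * x / (1 - x ^+ 2) = tan (atan x *+ 2).
  rewrite tan_mulr2n ?atanK ?mulr_natl//.
  by rewrite cos_atan invr_neq0// sqrtr_eq0 -ltNge ltr_pwDl// sqr_ge0.
have p0 := @pi_gt0 R.
by rewrite tanK ?mulr_natl// in_itv /=; apply/andP; split; lra.
Qed.

(* Five halvings of the angle: pi / 4 <= 32 * atan (26 / 1059). *)
Lemma pi_le : pi <= 3328 / 1059 :> R.
Proof.
have step (x y : R) : 0 < x < 1 -> y * (1 - x ^+ 2) <= 2 * x -> atan y <= 2 * atan x.
  move=> x01 h; rewrite -atan_double//; apply: le_atan.
  move: x01 => /andP[x0 x1]; rewrite ler_pdivlMr// subr_gt0.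
  by rewrite expr_lt1// ltW.
(* The fractions lie just above the tangents of pi/8, pi/16, pi/32, pi/64 and pi/128, so each
   doubling reaches the previous angle. *)
have s1 : atan 1 <= 2 * atan (169 / 408) :> R by apply: step; lra.
have s2 : atan (169 / 408) <= 2 * atan (110 / 553) :> R by apply: step; lra.
have s3 : atan (110 / 553) <= 2 * atan (59 / 599) :> R by apply: step; lra.
have s4 : atan (59 / 599) <= 2 * atan (48 / 977) :> R by apply: step; lra.
have s5 : atan (48 / 977) <= 2 * atan (26 / 1059) :> R by apply: step; lra.
have s6 : atan (26 / 1059) <= 26 / 1059 :> R by apply: atan_le_id; lra.
rewrite atan1 in s1; lra.
Qed.

End PiBound.

(** * From copies of the shapes to the frame of the rectangle *)

Section Placement.
Variable R : realType.
Local Notation zr := (@zr R).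
Implicit Types (S : set (R * R)) (p q t u v c z : R * R).

Lemma sign_choice (x : R) : exists s : R, [/\ s ^+ 2 = 1, `|s| = 1 & 0 <= s * x].
Proof.
have [x0|/ltW x0] := leP 0 x; [exists 1|exists (-1)].
  by rewrite expr1n normr1 mul1r.
by rewrite sqrrN expr1n normrN normr1 mulN1r oppr_ge0.
Qed.

(** [p] lies on the horizontal chord at its height, whose ends [(h, p.2)] and [(- h, p.2)] are on
    the circle. For [h = 0] the chord is a single point. *)
Lemma disk_sub S t (r : R) : convex_plane S -> 0 <= r ->
  (forall p, p.1 ^+ 2 + p.2 ^+ 2 = r ^+ 2 -> S (t.1 + p.1, t.2 + p.2)) ->
  forall p, p.1 ^+ 2 + p.2 ^+ 2 <= r ^+ 2 -> S (t.1 + p.1, t.2 + p.2).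
Proof.
move=> cS r0 circ p pr.
pose h := Num.sqrt (r ^+ 2 - p.2 ^+ 2).
have h2 : h ^+ 2 = r ^+ 2 - p.2 ^+ 2.
  by rewrite sqr_sqrtr// subr_ge0; apply: le_trans pr; rewrite lerDr sqr_ge0.
have Sm : S (t.1 - h, t.2 + p.2).
  by apply: (circ (- h, p.2)); rewrite /= sqrrN h2 subrK.
have Sp : S (t.1 + h, t.2 + p.2).
  by apply: (circ (h, p.2)); rewrite /= h2 subrK.
have h0 : 0 <= h by exact: sqrtr_ge0.
have : `|p.1| <= h.
  rewrite -(@ler_pXn2r _ 2) ?nnegrE// real_normK ?num_real// h2; move: pr; lra.
rewrite ler_norml => /andP[ph1 ph2].
have [E|hn0] := eqVneq h 0.
  have p0 : p.1 = 0 by move: ph1 ph2; rewrite E; lra.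
  by move: Sm; rewrite E subr0 p0 addr0.
have hpos : 0 < h by rewrite lt_neqAle eq_sym hn0.
have := cS _ _ Sp Sm ((p.1 + h) / (2 * h)).
rewrite divr_ge0; [|by move: ph1; lra|by rewrite mulr_ge0].
rewrite ler_pdivrMr; last by rewrite mulr_gt0.
have -> : p.1 + h <= 1 * (2 * h) by move: ph2; lra.
move=> /(_ isT isT) /=; congr (S (_, _)); by field.
Qed.

Lemma circle_copy_disk S : convex_plane S -> contains_copy S (circle_perim1 R) ->
  exists t, forall p, p.1 ^+ 2 + p.2 ^+ 2 <= (1 / (2 * pi)) ^+ 2 ->
    S (t.1 + p.1, t.2 + p.2).
Proof.
move=> cS [th [t sub]]; exists t; apply: disk_sub => // [|p pr].
  by rewrite divr_ge0// mulr_ge0// pi_ge0.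
(* The inverse rotation of [p], which is again on the circle. *)
apply: sub; exists (cos th * p.1 + sin th * p.2, - sin th * p.1 + cos th * p.2).
  rewrite /circle_perim1 /= -pr -[RHS]mul1r -(cos2Dsin2 th); ring.
have c2s2 := cos2Dsin2 th.
rewrite /rigid_motion /=; congr (_, _).
  rewrite -[t.1 + p.1](_ : (cos th ^+ 2 + sin th ^+ 2) * p.1 + t.1 = _); first by ring.
  by rewrite c2s2; ring.
rewrite -[t.2 + p.2](_ : (cos th ^+ 2 + sin th ^+ 2) * p.2 + t.2 = _); first by ring.
by rewrite c2s2; ring.
Qed.

Lemma affineD q u v c z : affine q u v (c.1 + z.1, c.2 + z.2) =
  ((affine q u v c).1 + (u.1 * z.1 + v.1 * z.2),
   (affine q u v c).2 + (u.2 * z.1 + v.2 * z.2)).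
Proof. by rewrite /affine /=; congr (_, _); ring. Qed.

(** The bound on pi gives 1 / (2 pi) >= 1059 / 6656 = 0.159104..., just above 0.1591. *)
Lemma radius_le : zr 15910 / zr 100000 <= 1 / (2 * pi).
Proof.
have p0 := @pi_gt0 R; have E0 := zr_pos R 100000; have q0 := zr_pos R 1059.
have ple : pi * zr 1059 <= zr 3328.
  rewrite -ler_pdivlMr//; apply: le_trans (@pi_le R) _.
  by rewrite -(zr_nat R 3328) -(zr_nat R 1059).
have num : zr 15910 * (2 * zr 3328) <= zr 100000 * zr 1059.
  by rewrite -(zr_nat R 2) -!zrM; apply: zr_le.
rewrite ler_pdivlMr ?mulr_gt0// mulrAC ler_pdivrMr// mul1r.
rewrite -(ler_pM2r q0); apply: le_trans num.
by rewrite -!mulrA !ler_wpM2l// ltW// zr_pos.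
Qed.

End Placement.

Theorem theorem1 (R : realType) (S : set (R * R)) :
  convex_plane S ->
  contains_copy S (circle_perim1 R) ->
  contains_copy S (segment_half R) ->
  contains_copy S (rectangle (1727 / 10000 : R) (3273 / 10000)) ->
  area_at_least S (1 / 10).
Proof.
move=> cS /(circle_copy_disk cS)[tc disk] [th2 [t2 seg]] [th [t rect]] A mA SA.
pose E := zr R 100000.
have E0 : 0 < E by exact: zr_pos.
have En0 : E != 0 by rewrite gt_eqF.
have Elit : E = 10 * 10000.
  by rewrite -(zr_nat R 10) -(zr_nat R 10000) -zrM.
have a2 : zr R 8635 * 2 = 1727 / 10000 * E.
  rewrite Elit mulrCA divfK ?pnatr_eq0// -(zr_nat R 2) -(zr_nat R 10) -(zr_nat R 1727) -!zrM.
  by congr (zr R _).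
have b2 : zr R 16365 * 2 = 3273 / 10000 * E.
  rewrite Elit mulrCA divfK ?pnatr_eq0// -(zr_nat R 2) -(zr_nat R 10) -(zr_nat R 3273) -!zrM.
  by congr (zr R _).
have E2 : E ^+ 2 = zr R 2000000000 * 5.
  by rewrite expr2 -(zr_nat R 5) -!zrM.
have E2' : E ^+ 2 = zr R 625000000 * 16.
  by rewrite expr2 -(zr_nat R 16) -!zrM.
have r2 : zr R 15910 ^+ 2 = zr R 253128100 by rewrite expr2 -!zrM.
(* From here on the side lengths enter only through [a2] and [b2], which keeps the literals away
   from [field]. *)
move: (1727 / 10000) (3273 / 10000) a2 b2 rect => aa bb a2 b2 rect.
clear Elit.
pose rho := cos th; pose sig := sin th.
have rs : rho ^+ 2 + sig ^+ 2 = 1 by exact: cos2Dsin2.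
(* [q0] and [M] are the centres of the copies of the rectangle and of the segment, kept opaque
   behind equations. *)
have [q0 q0E] : exists q, q = rigid_motion th t (aa / 2, bb / 2) by eexists.
have [M ME] : exists q, q = rigid_motion th2 t2 (1 / 4, 0) by eexists.
(* Coordinates along the sides of the rectangle: [d1], [d2] of the disk centre relative to [q0], and
   [f1], [f2] of the unit vector along the segment. *)
pose d1 := rho * (tc.1 - q0.1) + sig * (tc.2 - q0.2).
pose d2 := - sig * (tc.1 - q0.1) + rho * (tc.2 - q0.2).
pose f1 := rho * cos th2 + sig * sin th2.
pose f2 := - sig * cos th2 + rho * sin th2.
(* All symmetries are spent here: [s1] reflects the first axis to get [0 <= c.1], [k] swaps the ends
   of the segment to get [0 <= w.1], and [s2] reflects the second axis to get [0 <= w.2]. So [c.2]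
   may have either sign. *)
have [s1 [s12 s1n c0]] := sign_choice d1.
have [k [k2 kn w10]] := sign_choice (s1 * f1).
have [s2 [s22 s2n w20]] := sign_choice (k * f2).
pose u := (s1 * rho / E, s1 * sig / E); pose v := (- (s2 * sig) / E, s2 * rho / E).
have cuv : cross u v = s1 * s2 / E ^+ 2.
  by rewrite -[RHS]mul1r -rs /cross /u /v /=; field.
have s10 : s1 != 0 by rewrite -normr_eq0 s1n oner_neq0.
have s20 : s2 != 0 by rewrite -normr_eq0 s2n oner_neq0.
have uv0 : cross u v != 0.
  by rewrite cuv mulf_neq0 ?mulf_neq0// invr_neq0// expf_neq0.
have aff x y : affine q0 u v (E * (s1 * x), E * (s2 * y)) =
    (q0.1 + (rho * x - sig * y), q0.2 + (sig * x + rho * y)).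
  rewrite /affine /u /v /=; congr (_, _).
    rewrite [LHS](_ : _ = q0.1 + (s1 ^+ 2 * (rho * x) - s2 ^+ 2 * (sig * y))).
      by rewrite s12 s22 !mul1r.
    by field.
  rewrite [LHS](_ : _ = q0.2 + (s1 ^+ 2 * (sig * x) + s2 ^+ 2 * (rho * y))).
    by rewrite s12 s22 !mul1r.
  by field.
pose g1 := rho * (M.1 - q0.1)
  + sig * (M.2 - q0.2).
pose g2 := - sig * (M.1 - q0.1)
  + rho * (M.2 - q0.2).
pose c := (E * (s1 * d1), E * (s2 * d2)).
pose l := (E * (s1 * g1), E * (s2 * g2)).
pose w := (k * (s1 * f1) * (E / 4), s2 * (k * f2) * (E / 4)).
have cs2 := cos2Dsin2 th2.
have rf1 : rho * f1 - sig * f2 = cos th2.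
  by rewrite -[RHS]mul1r -rs /f1 /f2; ring.
have rf2 : sig * f1 + rho * f2 = sin th2.
  by rewrite -[RHS]mul1r -rs /f1 /f2; ring.
have rg1 : rho * g1 - sig * g2 = M.1 - q0.1.
  by rewrite -[RHS]mul1r -rs /g1 /g2; ring.
have rg2 : sig * g1 + rho * g2 = M.2 - q0.2.
  by rewrite -[RHS]mul1r -rs /g1 /g2; ring.
have tc1 : rho * d1 - sig * d2 = tc.1 - q0.1.
  by rewrite -[RHS]mul1r -rs /d1 /d2; ring.
have tc2 : sig * d1 + rho * d2 = tc.2 - q0.2.
  by rewrite -[RHS]mul1r -rs /d1 /d2; ring.
(* [j] runs along the segment from its midpoint, with half-length 1/4; the ends [j = k] and
   [j = - k] become l + w and l - w. *)
have segin (j : R) : -1 <= j <= 1 ->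
    S (affine q0 u v (E * (s1 * (g1 + j / 4 * f1)), E * (s2 * (g2 + j / 4 * f2)))).
  move=> j1; apply: seg; exists ((1 + j) / 4, 0).
    by rewrite /segment_half /=; split=> //; lra.
  rewrite aff /rigid_motion /=; congr (_, _).
    rewrite (_ : rho * _ - sig * _ = (rho * g1 - sig * g2) + j / 4 * (rho * f1 - sig * f2)).
      by rewrite rf1 rg1 ME /=; field.
    by ring.
  rewrite (_ : sig * _ + rho * _ = (sig * g1 + rho * g2) + j / 4 * (sig * f1 + rho * f2)).
    by rewrite rf2 rg2 ME /=; field.
  by ring.
have H : mixed_area_ge (affine q0 u v @^-1` S) (zr R 2000000000).
  have kb : -1 <= k <= 1 by rewrite -ler_norml kn.
  have kb' : -1 <= - k <= 1 by move: kb; lra.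
  have cS' : convex_plane (affine q0 u v @^-1` S) by exact: preimage_convex.
  apply: (frame_bound cS' (c := c) (l := l) (w := w)).
  - move=> p p1 p2; apply: rect.
    pose x := aa / 2 + s1 * p.1 / E; pose y := bb / 2 + s2 * p.2 / E.
    have bnd (s z e d : R) : `|s| = 1 -> `|z| <= e -> e * 2 = d * E ->
        0 <= d / 2 + s * z / E <= d.
      move=> sn zb e2; have : `|s * z / E| <= d / 2.
        rewrite !normrM sn mul1r normfV (gtr0_norm E0) ler_pdivrMr//.
        by move: zb; have -> : d / 2 * E = e by rewrite mulrAC -e2 mulfK ?pnatr_eq0.
      by rewrite ler_norml => /andP[]; lra.
    exists (x, y); first by split; apply: bnd; eassumption.
    rewrite /affine q0E /rigid_motion /u /v /x /y /=; congr (_, _); rewrite -/rho -/sig.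
      by field.
    by field.
  (* The linear part of [affine] is an isometry, possibly a reflection, divided by [E], so lengths
     scale by [1 / E]. *)
  - move=> z zr2; rewrite /preimage /mkset affineD aff tc1 tc2.
    have := disk (u.1 * z.1 + v.1 * z.2, u.2 * z.1 + v.2 * z.2).
    rewrite [in X in X -> _]/= !subrKC [in X in _ -> X]/=.
    have -> : (u.1 * z.1 + v.1 * z.2) ^+ 2 + (u.2 * z.1 + v.2 * z.2) ^+ 2 =
        (z.1 ^+ 2 + z.2 ^+ 2) / E ^+ 2.
      rewrite [LHS](_ : _ = (rho ^+ 2 + sig ^+ 2) *
        (s1 ^+ 2 * z.1 ^+ 2 + s2 ^+ 2 * z.2 ^+ 2) / E ^+ 2).
        by rewrite rs s12 s22 !mul1r.
      by rewrite /u /v /=; field.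
    have -> : (z.1 ^+ 2 + z.2 ^+ 2) / E ^+ 2 <= (1 / (2 * pi)) ^+ 2.
      apply: (@le_trans _ _ ((zr R 15910 / E) ^+ 2)).
        by rewrite exprMn exprVn r2 ler_wpM2r// invr_ge0 exprn_ge0// ltW.
      have r0 : 0 <= zr R 15910 / E by rewrite divr_ge0// ltW// zr_pos.
      rewrite ler_pXn2r ?nnegrE//; first exact: radius_le.
      exact: le_trans r0 (radius_le R).
    by apply.
  - move: (segin k kb); congr (S (affine _ _ _ _)).
    by rewrite /l /w; congr (_, _); rewrite /=; field.
  - move: (segin (- k) kb'); congr (S (affine _ _ _ _)).
    by rewrite /l /w; congr (_, _); rewrite /=; field.
  - rewrite /w /=.
    rewrite (_ : _ + _ = (k ^+ 2 * s1 ^+ 2 * f1 ^+ 2 + s2 ^+ 2 * k ^+ 2 * f2 ^+ 2) * (E ^+ 2 / 16)).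
      rewrite k2 s12 s22 E2' mulfK ?pnatr_eq0// !mul1r.
      rewrite (_ : f1 ^+ 2 + f2 ^+ 2 = (rho ^+ 2 + sig ^+ 2) * (cos th2 ^+ 2 + sin th2 ^+ 2)).
        by rewrite rs cs2 !mul1r.
      by rewrite /f1 /f2; ring.
    by field.
  - by rewrite mulr_ge0// ltW.
  - by rewrite mulr_ge0// divr_ge0// ltW.
  - by rewrite mulr_ge0// divr_ge0// ltW.
(* The determinant has absolute value [1 / E ^+ 2], and half of 2000000000 / 10^10 is 1/10. *)
apply: le_trans (area_mixed_ge uv0 cS H mA SA); rewrite lee_fin cuv.
rewrite !normrM s1n s2n normfV normrX (gtr0_norm E0) !mul1r.
rewrite E2; have := zr_pos R 2000000000; move: (zr R 2000000000) => z z0.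
by rewrite le_eqVlt; apply/orP; left; apply/eqP; field; rewrite gt_eqF.
Qed.
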